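(* Let $\epsilon_g\in(0,1)$. Suppose: (1) there is $0\le L_g<\infty$ with $\|\mathbf g(\mathbf x)-\mathbf g(\mathbf y)\|\le L_g\|\mathbf x-\mathbf y\|$ for all $\mathbf x,\mathbf y\in\mathbb R^d_+$; (2) there is $0\le L_H<\infty$ with $\|\mathbf H(\mathbf x)-\mathbf H(\mathbf y)\|\le L_H\|\mathbf x-\mathbf y\|$ for all $\mathbf x,\mathbf y\in\mathbb R^d_+$; (3) there is $f_*>-\infty$ with $f_*\le f(\mathbf x)$ on $\mathbb R^d_+$; (4) (residual regularity) there is $\omega>0$, independent of the iterate, such that whenever MINRES returns an NPC direction $\mathbf r_k^{\mathcal I}$ at an iteration $k$ of Algorithm 2, $\|\mathbf r_k^{\mathcal I}\|\ge\omega\|\mathbf g_k^{\mathcal I}\|$; (5) (Krylov subspace regularity) there is $\sigma>0$ such that at every iteration $k$ of Algorithm 2 at which MINRES returns SOL, say at its $t$-th iteration, the MINRES tridiagonal matrix satisfies $\mathbf T_t\succeq\sigma\mathbf I$, i.e. $\langle\mathbf v,\mathbf H_k^{\mathcal I}\mathbf v\rangle\ge\sigma\|\mathbf v\|^2$ for all $\mathbf v\in\mathcal K_t(\mathbf H_k^{\mathcal I},\mathbf g_k^{\mathcal I})$. Run Algorithm 2 (defined in the context) with $\delta_k=\epsilon_k=\epsilon_g^{1/2}$ for all $k$. Then it produces (and terminates at) an $\epsilon_g$-FO point in at most $\mathcal O(\epsilon_g^{-3/2})$ iterations; that is, in at most $C\epsilon_g^{-3/2}$ iterations, where $C$ depends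 only on $f(\mathbf x_0)-f_*$, $L_g,L_H,\sigma,\omega,\theta,\rho,\zeta$ (and not on $\epsilon_g$).
   Context: **Notation.** $f:\mathbb R^d\to\mathbb R$ is twice continuously differentiable (possibly nonconvex); the problem is $\min f(\mathbf x)$ subject to $\mathbf x\ge\mathbf 0$. $\mathbb R^d_+=\{\mathbf x:\mathbf x\ge \mathbf 0\}$, $\mathbf g=\nabla f$, $\mathbf H=\nabla^2 f$, $[\mathcal P(\mathbf x)]^i=\max\{\mathbf x^i,0\}$. For $\mathbf x\in\mathbb R^d_+$, $\delta>0$: $\mathcal A(\mathbf x,\delta)=\{i:0\le \mathbf x^i\le\delta\}$, $\mathcal I(\mathbf x,\delta)=\{i:\mathbf x^i>\delta\}$. For an index set $S$, $\mathbf v^S$ is the subvector and $\mathbf H^S$ the principal submatrix indexed by $S$. Subscript $k$ means evaluation at $\mathbf x_k$; superscripts $\mathcal A,\mathcal I$ at iteration $k$ refer to $\mathcal A(\mathbf x_k,\delta_k)$, $\mathcal I(\mathbf x_k,\delta_k)$. Terms over empty index sets are $0$. **$\epsilon$-FO point.** $\mathbf x\in\mathbb R^d_+$ is $\epsilon$-FO if, with $\mathcal A=\mathcal A(\mathbf x,\sqrt\epsilon)$, $\mathcal I=\mathcal I(\mathbf x,\sqrt\epsilon)$, $\mathbf g=\mathbf g(\mathbf x)$: (a) $\mathbf g^i\ge-\sqrt\epsilon$ for all $i\in\mathcal A$; (b) $\|\mathrm{diag}(\mathbf x^{\mathcal A})\mathbf g^{\mathcal A}\|\le\epsilon$; (c)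 $\|\mathbf g^{\mathcal I}\|\le\epsilon$ (conditions over empty sets hold trivially). **MINRES$(\mathbf B,\mathbf b,\eta,\vartheta)$.** For symmetric $\mathbf B\in\mathbb R^{n\times n}$, $\mathbf b\in\mathbb R^n$, let $\mathcal K_t(\mathbf B,\mathbf b)=\mathrm{Span}\{\mathbf b,\dots,\mathbf B^{t-1}\mathbf b\}$, $\mathbf s^{(0)}=\mathbf 0$, $\mathbf s^{(t)}=\arg\min_{\mathbf s\in\mathcal K_t(\mathbf B,\mathbf b)}\|\mathbf B\mathbf s+\mathbf b\|^2$, $\mathbf r^{(t)}=-\mathbf B\mathbf s^{(t)}-\mathbf b$. For $t=1,2,\dots$: if $\mathbf r^{(t-1)}\ne\mathbf 0$ and $\langle\mathbf r^{(t-1)},\mathbf B\mathbf r^{(t-1)}\rangle\le\vartheta\|\mathbf r^{(t-1)}\|^2$, stop and return $(\mathbf r^{(t-1)},\mathrm{NPC})$; otherwise, if $\|\mathbf B\mathbf r^{(t-1)}\|\le\eta\|\mathbf B\mathbf s^{(t-1)}\|$, stop and return $(\mathbf s^{(t-1)},\mathrm{SOL})$; otherwise continue. The tridiagonal matrix is $\mathbf T_t=\mathbf V_t^{\top}\mathbf B\mathbf V_t$, where the columns of $\mathbf V_t$ are the Lanczos orthonormal basis of $\mathcal K_t(\mathbf B,\mathbf b)$. **Line search.** With $\mathbf x_k(\alpha)=\mathcal P(\mathbf x_k+\alpha\mathbf p_k)$, the criterion is $$f(\mathbf x_k(\alpha))-f(\mathbf x_k)\le\rho\langle\mathbf g_k^{\mathcal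 A},\mathcal P(\mathbf x_k^{\mathcal A}+\alpha\mathbf p_k^{\mathcal A})-\mathbf x_k^{\mathcal A}\rangle+\alpha\rho\langle\mathbf g_k^{\mathcal I},\mathbf p_k^{\mathcal I}\rangle.$$ Backtracking: start from $\alpha=1$ and replace $\alpha$ by $\zeta\alpha$ until the criterion holds. Forward/backward tracking: if the criterion fails at $\alpha=1$, backtrack; otherwise replace $\alpha$ by $\alpha/\zeta$ while the criterion holds and return $\zeta\alpha$ for the first failing $\alpha$. **Algorithm 2.** Parameters: $\mathbf x_0\ge\mathbf 0$, $\theta>0$, $\eta=\epsilon_k\theta$, $\rho\in(0,1/2)$, $\zeta\in(0,1)$. For $k=0,1,\dots$ (with $\delta_k=\epsilon_k=\sqrt{\epsilon_g}$): if $\mathcal A\ne\emptyset$ and ((a) or (b) with $\epsilon=\epsilon_g$ fails at $\mathbf x_k$), the step is Type I; else if $\mathcal I\ne\emptyset$ and (c) with $\epsilon=\epsilon_g$ fails, the step is Type II; else terminate. Set $\mathbf p_k^{\mathcal A}=-\mathbf g_k^{\mathcal A}$ for Type I and $\mathbf p_k^{\mathcal A}=\mathbf 0$ for Type II; if $\mathcal I\neq\emptyset$, $(\mathbf p_k^{\mathcal I},D)=\mathrm{MINRES}(\mathbf H_k^{\mathcal I},\mathbf g_k^{\mathcal I},\eta,0)$. Choose $\alpha_k$ by backtracking if $D=\mathrm{SOL}$ (or $\mathcal I=\emptyset$) and by forward/backward tracking if $D=\mathrm{NPC}$. Set $\mathbf x_{k+1}=\mathcal P(\mathbf x_k+\alpha_k\mathbf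 p_k)$. *)

(* Defs.v *)
From mathcomp Require Import all_boot all_order all_algebra.
From mathcomp Require Import all_classical all_reals all_analysis.

Set Implicit Arguments.
Unset Strict Implicit.
Unset Printing Implicit Defensive.

Import Order.TTheory GRing.Theory Num.Theory.
Import numFieldNormedType.Exports.

Local Open Scope classical_set_scope.
Local Open Scope ring_scope.

Section Euclidean.
Context {R : realType}.

Definition dot {n : nat} (u v : 'cV[R]_n) : R := \sum_i u i 0 * v i 0.

(* The library norm on matrices is the max norm, hence this definition. *)
Definition enorm {n : nat} (u : 'cV[R]_n) : R := Num.sqrt (dot u u).

(* Spectral norm. *)
Definition opnorm {n : nat} (A : 'M[R]_n) : R :=
  sup [set enorm (A *m v) | v in [set v : 'cV[R]_n | enorm v <= 1]].

Definition nonneg {n : nat} (x : 'cV[R]_n) : bool := [forall i, 0 <= x i 0].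

Definition proj {n : nat} (x : 'cV[R]_n) : 'cV[R]_n :=
  \col_i Num.max (x i 0) 0.

Definition subvec {n : nat} (S : {set 'I_n}) (v : 'cV[R]_n) : 'cV[R]_#|S| :=
  \col_i v (enum_val i) 0.

Definition submat {n : nat} (S : {set 'I_n}) (A : 'M[R]_n) : 'M[R]_#|S| :=
  \matrix_(i, j) A (enum_val i) (enum_val j).

Definition active {n : nat} (x : 'cV[R]_n) (delta : R) : {set 'I_n} :=
  [set i | 0 <= x i 0 <= delta]%SET.

Definition inactive {n : nat} (x : 'cV[R]_n) (delta : R) : {set 'I_n} :=
  [set i | delta < x i 0]%SET.

End Euclidean.

Section Calculus.
Context {R : realType} {d : nat}.
Implicit Types (f : 'cV[R]_d -> R) (x : 'cV[R]_d).

Definition grad f x : 'cV[R]_d := \col_i 'D_(delta_mx i 0) f x.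

Definition hess f x : 'M[R]_d :=
  \matrix_(i, j) 'D_(delta_mx j 0) (fun y => grad f y i 0) x.

Definition C2 f : Prop :=
  [/\ forall x, differentiable f x,
      forall x, differentiable (grad f) x
    & continuous (hess f)].

End Calculus.

Section Minres.
Context {R : realType} {n : nat}.
Implicit Types (B : 'M[R]_n) (b s r p : 'cV[R]_n).

Definition krylov B b (t : nat) : {vspace 'cV[R]_n} :=
  <<[seq B ^+ i *m b | i <- iota 0 t]>>%VS.

(* For t = 0 the Krylov space is zero, which forces s = 0. *)
Definition minres_iterate B b (t : nat) s : Prop :=
  s \in krylov B b t /\
  forall s', s' \in krylov B b t ->
    enorm (B *m s + b) ^+ 2 <= enorm (B *m s' + b) ^+ 2.

Definition residual B b s : 'cV[R]_n := - (B *m s) - b.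

Definition npc_test B (vartheta : R) r : bool :=
  (r != 0) && (dot r (B *m r) <= vartheta * enorm r ^+ 2).

Definition sol_test B (eta : R) r s : bool :=
  enorm (B *m r) <= eta * enorm (B *m s).

Variant minres_flag := NPC | SOL.

(* minres B b eta vartheta t p D: MINRES stops at its t-th iteration and
   returns (p, D). *)
Definition minres B b (eta vartheta : R) (t : nat) p (D : minres_flag) : Prop :=
  exists s : nat -> 'cV[R]_n,
    let r j := residual B b (s j) in
    [/\ (0 < t)%N,
        forall j, (j < t)%N -> minres_iterate B b j (s j),
        forall j, (j < t.-1)%N ->
          ~~ npc_test B vartheta (r j) && ~~ sol_test B eta (r j) (s j)
      & match D with
        | NPC => npc_test B vartheta (r t.-1) /\ p = r t.-1
        | SOL => [/\ ~~ npc_test B vartheta (r t.-1),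
                     sol_test B eta (r t.-1) (s t.-1) & p = s t.-1]
        end].

End Minres.

Section LineSearch.
Context {R : realType}.
Implicit Types (crit : R -> bool) (zeta alpha : R).

Definition backtracking crit zeta alpha : Prop :=
  exists m : nat, [/\ alpha = zeta ^+ m, crit (zeta ^+ m)
    & forall j, (j < m)%N -> ~~ crit (zeta ^+ j)].

Definition forward_backward crit zeta alpha : Prop :=
  if crit 1 then
    exists m : nat, [/\ alpha = zeta * zeta ^- m, ~~ crit (zeta ^- m)
      & forall j, (j < m)%N -> crit (zeta ^- j)]
  else backtracking crit zeta alpha.

End LineSearch.

Section FirstOrder.
Context {R : realType} {d : nat}.
Variable f : 'cV[R]_d -> R.
Implicit Types (eps : R) (x : 'cV[R]_d).

Definition FO_a eps x : bool :=
  [forall i in active x (Num.sqrt eps), - Num.sqrt eps <= grad f x i 0].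

Definition FO_b eps x : bool :=
  let A := active x (Num.sqrt eps) in
  enorm (diag_mx (subvec A x)^T *m subvec A (grad f x)) <= eps.

Definition FO_c eps x : bool :=
  enorm (subvec (inactive x (Num.sqrt eps)) (grad f x)) <= eps.

Definition FO_point eps x : bool :=
  [&& nonneg x, FO_a eps x, FO_b eps x & FO_c eps x].

End FirstOrder.

(* The algorithm with delta_k = eps_k = Num.sqrt eps_g for all k. *)
Section Algorithm2.
Context {R : realType} {d : nat}.
Variables (f : 'cV[R]_d -> R) (eps_g theta rho zeta : R).
Implicit Types (x y p : 'cV[R]_d) (alpha : R).

Local Notation A x := (active x (Num.sqrt eps_g)).
Local Notation I x := (inactive x (Num.sqrt eps_g)).

Definition typeI x : bool :=
  (A x != finset.set0) && (~~ FO_a f eps_g x || ~~ FO_b f eps_g x).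

Definition typeII x : bool :=
  [&& ~~ typeI x, I x != finset.set0 & ~~ FO_c f eps_g x].

Definition alg2_stop x : bool := ~~ typeI x && ~~ typeII x.

Definition alg2_minres x (t : nat) (pI : 'cV[R]_#|I x|) (D : minres_flag) :
    Prop :=
  minres (submat (I x) (hess f x)) (subvec (I x) (grad f x))
    (Num.sqrt eps_g * theta) 0 t pI D.

(* Since x >= 0, the index sets A x and I x partition 'I_d, so p is determined
   by its two blocks.  When I x is empty, D = SOL selects backtracking. *)
Definition alg2_direction x p (D : minres_flag) : Prop :=
  subvec (A x) p = (if typeI x then - subvec (A x) (grad f x) else 0) /\
  (if I x == finset.set0 then D = SOL
   else exists t, alg2_minres t (subvec (I x) p) D).

Definition line_search_crit x p alpha : bool :=
  let g := grad f x in
  f (proj (x + alpha *: p)) - f x <=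
    rho * dot (subvec (A x) g)
              (proj (subvec (A x) x + alpha *: subvec (A x) p) - subvec (A x) x)
    + alpha * rho * dot (subvec (I x) g) (subvec (I x) p).

Definition alg2_line_search x p (D : minres_flag) alpha : Prop :=
  match D with
  | SOL => backtracking (line_search_crit x p) zeta alpha
  | NPC => forward_backward (line_search_crit x p) zeta alpha
  end.

Definition alg2_step x y : Prop :=
  exists p D alpha,
    [/\ ~~ alg2_stop x, alg2_direction x p D, alg2_line_search x p D alpha
      & y = proj (x + alpha *: p)].

(* alg2_iterate x0 k x: x is the k-th iterate of an execution started at x0. *)
Inductive alg2_iterate (x0 : 'cV[R]_d) : nat -> 'cV[R]_d -> Prop :=
| alg2_iterate0 : alg2_iterate x0 0 x0
| alg2_iterateS k x y :
    alg2_iterate x0 k x -> alg2_step x y -> alg2_iterate x0 k.+1 y.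

End Algorithm2.

Section Assumptions.
Context {R : realType} {d : nat}.
Variables (f : 'cV[R]_d -> R) (eps_g theta rho zeta : R) (x0 : 'cV[R]_d).

Local Notation I x := (inactive x (Num.sqrt eps_g)).
Local Notation iterate := (alg2_iterate f eps_g theta rho zeta x0).

Definition residual_regularity (omega : R) : Prop :=
  forall k x t (r : 'cV[R]_#|I x|), iterate k x -> ~~ alg2_stop f eps_g x -> I x != finset.set0 ->
    alg2_minres f theta t r NPC ->
    omega * enorm (subvec (I x) (grad f x)) <= enorm r.

(* The condition on krylov ... t says that the Lanczos tridiagonal matrix T_t
   satisfies T_t >= sigma I. *)
Definition krylov_regularity (sigma : R) : Prop :=
  forall k x t (s : 'cV[R]_#|I x|), iterate k x -> ~~ alg2_stop f eps_g x -> I x != finset.set0 ->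
    alg2_minres f theta t s SOL ->
    let HI := submat (I x) (hess f x) in
    forall v, v \in krylov HI (subvec (I x) (grad f x)) t ->
      sigma * enorm v ^+ 2 <= dot v (HI *m v).

End Assumptions.

(* Main.v *)
Require Import Defs.
From mathcomp Require Import all_boot all_order all_algebra.
From mathcomp Require Import all_classical all_reals all_analysis.
From mathcomp Require Import ring lra.
Import Order.TTheory GRing.Theory Num.Theory.
Import numFieldNormedType.Exports.
Set Implicit Arguments.
Unset Strict Implicit.
Unset Printing Implicit Defensive.
Local Open Scope classical_set_scope.
Local Open Scope ring_scope.

(** Write e for the square root of eps_g.  Apart from one harmless exception,
    every iteration lowers f by a fixed multiple of e ^+ 3; since f cannot fall
    below fstar, there are O(e ^- 3) iterations.

    On the inactive block MINRES returns a direction of slope at most - mu * q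
    ^+ 2, where q is the length of the direction and mu the minimum of 1 and
    sigma. For a direction of nonpositive curvature this is because a MINRES
    residual r satisfies dot b r = - dot r r. For a solution s it requires dot
    (res s) s >= 0, which fails for least squares over a general subspace and
    comes from the Krylov structure: as long as the residuals r_j have positive
    curvature, MINRES follows the conjugate residual recursion with positive
    coefficients, whence s = - c *: b + B w with c >= 0 and w in the Krylov
    space ([conjugate_residual_cone]); optimality of s makes res s orthogonal to
    B w.

    Along the projected path, the first-order bound then validates every step
    alpha <= kap, for a small constant kap, such that alpha * q <= e; the latter
    keeps the inactive coordinates, all larger than e, nonnegative
    ([crit_first_order]). So an accepted step is bounded below by a constant, or
    it moves the inactive block by at least zeta * e along a direction at least
    as long as e ([step_size_dichotomy]), in which case the slope alone pays for
    e ^+ 2.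
    There remain three cases.

    - Type I: failure of (a) or (b) forces a decrease of order e ^+ 2 on the
      active block ([typeI_active_decrease]).
    - Type II, direction of nonpositive curvature: q is at least of order e ^+ 2 by
      residual regularity.  The curvature term has the good sign, so that only the
      cubic remainder restricts the step, which is therefore at least of order
      e / q.  The decrease alpha * q ^+ 2 is then of order e ^+ 3.
    - Type II, approximate solution: if q > kap * e the decrease is of order
      e ^+ 2.  Otherwise the unit step is accepted, because rho < 1 / 2
      ([crit_full_step]), and Taylor's formula for the gradient together with the
      MINRES tolerance shows that (c) holds at the next iterate
      ([full_step_not_typeII]).  This is the exception: such a step may gain
      little, but it does not increase f, and either the next iterate is terminal
      or the next step is of Type I.

    Thus at least every second step is paid for ([iteration_count]).  No execution
    gets stuck: MINRES stops once the Krylov spaces are stationary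
    ([minres_terminates]), backtracking reaches the range of [crit_first_order],
    and forward tracking ends because f is bounded below. *)

(** * Euclidean geometry *)

Section Euclid.
Context {R : realType} {n : nat}.
Implicit Types (u v w : 'cV[R]_n) (a : R) (A : 'M[R]_n).

Lemma dotC u v : dot u v = dot v u.
Proof. by apply: eq_bigr => i _; rewrite mulrC. Qed.

Lemma dotDl u v w : dot (u + v) w = dot u w + dot v w.
Proof. by rewrite /dot -big_split; apply: eq_bigr => i _; rewrite mxE mulrDl. Qed.

Lemma dotZl a u v : dot (a *: u) v = a * dot u v.
Proof. by rewrite /dot mulr_sumr; apply: eq_bigr => i _; rewrite mxE mulrA. Qed.

Lemma dotDr u v w : dot w (u + v) = dot w u + dot w v.
Proof. by rewrite dotC dotDl ![dot _ w]dotC. Qed.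

Lemma dotZr a u v : dot u (a *: v) = a * dot u v.
Proof. by rewrite dotC dotZl dotC. Qed.

Lemma dotNl u v : dot (- u) v = - dot u v.
Proof. by rewrite -scaleN1r dotZl mulN1r. Qed.

Lemma dotNr u v : dot u (- v) = - dot u v.
Proof. by rewrite dotC dotNl dotC. Qed.

Lemma dotBl u v w : dot (u - v) w = dot u w - dot v w.
Proof. by rewrite dotDl dotNl. Qed.

Lemma dotBr u v w : dot w (u - v) = dot w u - dot w v.
Proof. by rewrite dotDr dotNr. Qed.

Lemma dot0l v : dot 0 v = 0.
Proof. by rewrite -(scale0r 0) dotZl mul0r. Qed.

Lemma dot0r v : dot v 0 = 0.
Proof. by rewrite dotC dot0l. Qed.

Lemma dot_ge0 u : 0 <= dot u u.
Proof. by apply: sumr_ge0 => i _; rewrite -expr2 sqr_ge0. Qed.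

Lemma dot_eq0 u : (dot u u == 0) = (u == 0).
Proof.
rewrite psumr_eq0; last by move=> i _; rewrite -expr2 sqr_ge0.
apply/allP/eqP => [u0|-> i _]; last by rewrite !mxE mulr0 eqxx.
apply/matrixP => i j; rewrite (ord1 j) [RHS]mxE; apply/eqP.
by have := u0 i (mem_index_enum i); rewrite /= mulf_eq0 orbb.
Qed.

Lemma dot_gt0 u : (0 < dot u u) = (u != 0).
Proof. by rewrite lt_neqAle dot_ge0 andbT eq_sym dot_eq0. Qed.

Lemma enorm_ge0 u : 0 <= enorm u.
Proof. exact: sqrtr_ge0. Qed.

Lemma enorm_sqr u : enorm u ^+ 2 = dot u u.
Proof. by rewrite sqr_sqrtr ?dot_ge0. Qed.

Lemma enorm0 : enorm (0 : 'cV[R]_n) = 0.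
Proof. by rewrite /enorm dot0l sqrtr0. Qed.

Lemma enorm_eq0 u : (enorm u == 0) = (u == 0).
Proof. by rewrite -dot_eq0 -enorm_sqr sqrf_eq0. Qed.

Lemma enorm_le u a : 0 <= a -> (enorm u <= a) = (dot u u <= a ^+ 2).
Proof. by move=> a0; rewrite -enorm_sqr ler_sqr ?nnegrE ?enorm_ge0. Qed.

Lemma enormZ a u : enorm (a *: u) = `|a| * enorm u.
Proof.
by rewrite /enorm dotZl dotZr mulrA -expr2 sqrtrM ?sqr_ge0 // sqrtr_sqr.
Qed.

Lemma enormN u : enorm (- u) = enorm u.
Proof. by rewrite /enorm dotNl dotNr opprK. Qed.

Lemma dot_le u v : dot u v <= enorm u * enorm v.
Proof.
have [->|u0] := eqVneq u 0; first by rewrite dot0l enorm0 mul0r.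
have up : 0 < enorm u by rewrite lt_neqAle enorm_ge0 eq_sym enorm_eq0 u0.
have [->|v0] := eqVneq v 0; first by rewrite dot0r enorm0 mulr0.
have vp : 0 < enorm v by rewrite lt_neqAle enorm_ge0 eq_sym enorm_eq0 v0.
have := dot_ge0 (enorm v *: u - enorm u *: v).
rewrite dotBl !dotBr !dotZl !dotZr -!enorm_sqr (dotC v u).
have uv : 0 < enorm u * enorm v by rewrite mulr_gt0.
rewrite (_ : _ - _ = 2 * (enorm u * enorm v * (enorm u * enorm v - dot u v)));
  last ring.
by rewrite pmulr_rge0 // pmulr_rge0 // subr_ge0.
Qed.

Lemma ler_enormD u v : enorm (u + v) <= enorm u + enorm v.
Proof.
rewrite enorm_le ?addr_ge0 ?enorm_ge0 // dotDl !dotDr -!enorm_sqr (dotC v u).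
by have := dot_le u v; nra.
Qed.

Lemma dot_mulmx_sym A u v : A^T = A -> dot u (A *m v) = dot (A *m u) v.
Proof.
have dotE x y : dot x y = (x^T *m y) 0 0.
  by rewrite mxE; apply: eq_bigr => i _; rewrite mxE.
by move=> sA; rewrite !dotE trmx_mul sA mulmxA.
Qed.

(** The spectral norm is a supremum, which is junk unless the set is bounded;
    Cauchy-Schwarz on the rows provides a bound. *)
Lemma enorm_mulmx_bound A : exists M : R, forall v, enorm (A *m v) <= M * enorm v.
Proof.
pose M := \sum_i dot (row i A)^T (row i A)^T.
have M0 : 0 <= M by apply: sumr_ge0 => i _; exact: dot_ge0.
exists (Num.sqrt M) => v.
rewrite enorm_le ?mulr_ge0 ?sqrtr_ge0 ?enorm_ge0 // exprMn sqr_sqrtr // enorm_sqr.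
rewrite /M mulr_suml; apply: ler_sum => i _.
have -> : (A *m v) i 0 = dot (row i A)^T v.
  by rewrite mxE; apply: eq_bigr => j _; rewrite !mxE.
set w := (row i A)^T; rewrite -expr2 -!enorm_sqr -exprMn -[leLHS]real_normK ?num_real //.
rewrite ler_sqr ?nnegrE ?mulr_ge0 ?enorm_ge0 // ler_norml lerNl -dotNl.
by rewrite -{1}(enormN w) !dot_le.
Qed.

Lemma enorm_mulmx_le A v : enorm (A *m v) <= opnorm A * enorm v.
Proof.
have [->|v0] := eqVneq v 0; first by rewrite mulmx0 enorm0 mulr0.
have vp : 0 < enorm v by rewrite lt_neqAle enorm_ge0 eq_sym enorm_eq0 v0.
rewrite -ler_pdivrMr // mulrC -[_^-1]ger0_norm ?invr_ge0 ?enorm_ge0 //.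
rewrite -enormZ scalemxAr; apply: ub_le_sup.
  have [M hM] := enorm_mulmx_bound A; exists `|M| => _ [w /= w1 <-].
  rewrite (le_trans (hM w)) // (le_trans (ler_wpM2r (enorm_ge0 w) (ler_norm M))) //.
  by rewrite ler_piMr.
exists ((enorm v)^-1 *: v) => //=.
by rewrite enormZ ger0_norm ?invr_ge0 ?enorm_ge0 // mulVf ?gt_eqF.
Qed.

End Euclid.

(** * Blocks of coordinates *)

Section Blocks.
Context {R : realType} {n : nat}.
Implicit Types (u v p : 'cV[R]_n) (S T : {set 'I_n}) (A : 'M[R]_n).

Lemma subvecD S u v : subvec S (u + v) = subvec S u + subvec S v.
Proof. by apply/matrixP => i j; rewrite !mxE. Qed.

Lemma subvecB S u v : subvec S (u - v) = subvec S u - subvec S v.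
Proof. by apply/matrixP => i j; rewrite !mxE. Qed.

Lemma subvecZ S a u : subvec S (a *: u) = a *: subvec S u.
Proof. by apply/matrixP => i j; rewrite !mxE. Qed.

Lemma subvec_proj S u : subvec S (Defs.proj u) = Defs.proj (subvec S u).
Proof. by apply/matrixP => i j; rewrite !mxE. Qed.

Lemma subvec_eqP S u v :
  subvec S u = subvec S v <-> {in S, forall i, u i 0 = v i 0}.
Proof.
split=> [/matrixP uv i iS|uv].
  by have := uv (enum_rank_in iS i) 0; rewrite !mxE enum_rankK_in.
by apply/matrixP => i j; rewrite !mxE uv // enum_valP.
Qed.

Lemma subvec_eq0P S u : subvec S u = 0 <-> {in S, forall i, u i 0 = 0}.
Proof.
have -> : (0 : 'cV[R]_#|S|) = subvec S (0 : 'cV[R]_n).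
  by apply/matrixP => i j; rewrite !mxE.
rewrite subvec_eqP; split=> h i iS; have := h i iS; by rewrite mxE.
Qed.

Lemma dot_subvec S u v : dot (subvec S u) (subvec S v) = \sum_(i in S) u i 0 * v i 0.
Proof. by rewrite big_enum_val; apply: eq_bigr => i _; rewrite !mxE. Qed.

Lemma dot_split S u v :
  dot u v = dot (subvec S u) (subvec S v) + dot (subvec (~: S) u) (subvec (~: S) v).
Proof.
rewrite !dot_subvec /dot (bigID (mem S)) /=; congr (_ + _).
by apply: eq_bigl => i; rewrite inE.
Qed.

Lemma enorm_subvecS S T u : S \subset T -> enorm (subvec S u) <= enorm (subvec T u).
Proof.
move=> /fintype.subsetP ST; rewrite enorm_le ?enorm_ge0 // enorm_sqr !dot_subvec.
rewrite [leRHS](bigID (mem S)) /=.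
have -> : \sum_(i in T | i \in S) u i 0 * u i 0 = \sum_(i in S) u i 0 * u i 0.
  by apply: eq_bigl => i; case: (boolP (i \in S)) => [/ST ->|]; rewrite ?andbF.
by rewrite lerDl sumr_ge0 // => i _; rewrite -expr2 sqr_ge0.
Qed.

Lemma enorm_subvec S u : enorm (subvec S u) <= enorm u.
Proof.
rewrite enorm_le ?enorm_ge0 // enorm_sqr (dot_split S u u) lerDl; exact: dot_ge0.
Qed.

Lemma enorm_supp S p : subvec (~: S) p = 0 -> enorm p = enorm (subvec S p).
Proof. by move=> p0; rewrite /enorm (dot_split S) p0 dot0l addr0. Qed.

Lemma subvec_mulmx S A p :
  subvec (~: S) p = 0 -> subvec S (A *m p) = submat S A *m subvec S p.
Proof.
move=> /subvec_eq0P p0; apply/matrixP => i j; rewrite !mxE (ord1 j).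
rewrite (bigID (mem S)) /= [X in _ + X]big1 ?addr0; last first.
  by move=> k kS; rewrite p0 ?mulr0 // inE.
by rewrite big_enum_val; apply: eq_bigr => k _; rewrite !mxE.
Qed.

(** The vector that carries v on S and vanishes elsewhere: a right inverse of
    [subvec]. *)
Definition embed S (v : 'cV[R]_#|S|) : 'cV[R]_n :=
  \sum_j v j 0 *: delta_mx (enum_val j) 0.

Lemma subvec_embed S (v : 'cV[R]_#|S|) : subvec S (embed v) = v.
Proof.
apply/matrixP => i j; rewrite (ord1 j) mxE summxE (bigD1 i) //= big1 ?addr0.
  by rewrite !mxE !eqxx mulr1.
move=> k ki; rewrite !mxE (inj_eq enum_val_inj) eq_sym (negPf ki) /= mulr0 //.
Qed.

Lemma subvec_embedC S T (v : 'cV[R]_#|S|) :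
  {in T, forall i, i \notin S} -> subvec T (embed v) = 0.
Proof.
move=> dST; apply/subvec_eq0P => i iT; rewrite summxE big1 // => j _.
rewrite !mxE; case: eqP => [E|]; last by rewrite mulr0.
by have := dST i iT; rewrite E enum_valP.
Qed.

End Blocks.

(** * Krylov spaces *)

Section Krylov.
Context {R : realType} {n : nat}.
Variables (B : 'M[R]_n) (b : 'cV[R]_n).
Local Notation K := (krylov B b).

Lemma krylovSP t v :
  reflect (exists2 u, u \in K t & exists a, v = u + a *: (B ^+ t *m b)) (v \in K t.+1).
Proof.
rewrite /krylov -(addn1 t) iotaD map_cat span_cat /= span_seq1 add0n.
apply: (iffP memv_addP) => [[u uK [w /vlineP[a ->] ->]]|[u uK [a ->]]].
  by exists u => //; exists a.
by exists u => //; exists (a *: (B ^+ t *m b)); rewrite ?memvZ ?memv_line.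
Qed.

Lemma krylov0 v : (v \in K 0) = (v == 0).
Proof. by rewrite /krylov /= span_nil memv0. Qed.

Lemma krylovS t : (K t <= K t.+1)%VS.
Proof. by apply/subvP => v vK; apply/krylovSP; exists v => //; exists 0; rewrite scale0r addr0. Qed.

Lemma krylov_le t t' : (t <= t')%N -> (K t <= K t')%VS.
Proof.
move/subnK => <-; elim: (_ - _)%N => // m IH.
by rewrite addSn (subv_trans IH) ?krylovS.
Qed.

Lemma krylov_mulmx t v : v \in K t -> B *m v \in K t.+1.
Proof.
elim: t v => [|t IH] v.
  by rewrite krylov0 => /eqP ->; rewrite mulmx0 mem0v.
case/krylovSP => u /IH Bu [a ->]; apply/krylovSP; exists (B *m u) => //.
by exists a; rewrite mulmxDr -scalemxAr mulmxA exprS.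
Qed.

Lemma krylov_start t : b \in K t.+1.
Proof.
apply: (subvP (krylov_le (ltn0Sn t))); apply/krylovSP; exists 0; rewrite ?mem0v //.
by exists 1; rewrite expr0 mul1mx scale1r add0r.
Qed.

Lemma krylov_residual t s : s \in K t -> residual B b s \in K t.+1.
Proof. by move=> sK; rewrite memvB ?memvN ?krylov_mulmx ?krylov_start. Qed.

(** Each Krylov space adds at most one dimension to the previous one, so any of
    its new vectors may replace the last generator. *)
Lemma krylovS_exchange t p v : p \in K t.+1 -> p \notin K t -> v \in K t.+1 ->
  exists2 u, u \in K t & exists c, v = u + c *: p.
Proof.
case/krylovSP => u1 u1K [a1 ->] p_out /krylovSP[u2 u2K [a2 ->]].
have a1n0 : a1 != 0.
  by apply: contraNneq p_out => ->; rewrite scale0r addr0.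
exists (u2 - (a2 / a1) *: u1); first by rewrite rpredB ?rpredZ.
by exists (a2 / a1); rewrite scalerDr addrA subrK scalerA divfK.
Qed.

(** Otherwise the dimensions would increase strictly for ever. *)
Lemma krylov_stationary : exists t, K t.+1 = K t.
Proof.
suff [t tn] : exists t, (\dim (K t.+1) <= \dim (K t))%N.
  by exists t; apply/esym/eqP; rewrite -(geq_leqif (dimv_leqif_eq (krylovS t))).
apply: contrapT => /forallNP h.
have dimK t : (t <= \dim (K t))%N.
  elim: t => // t IH; apply: (leq_ltn_trans IH).
  by rewrite ltnNge; apply/negP/h.
have := leq_trans (dimK (\dim {: 'cV[R]_n}).+1) (dimvS (subvf _)).
by rewrite ltnn.
Qed.

End Krylov.

(** Gram-Schmidt: the orthogonal part u of each new generator is handled by one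
    explicit coefficient.  If u = 0, that coefficient is divided by zero, which
    gives 0 and is correct. *)
Lemma orthogonal_decomposition {R : realType} {n : nat} (vs : seq 'cV[R]_n) (y : 'cV[R]_n) :
  exists2 w, w \in <<vs>>%VS & forall v, v \in <<vs>>%VS -> dot (y - w) v = 0.
Proof.
elim: vs y => [|v vs IH] y.
  exists 0; first by rewrite mem0v.
  by move=> v; rewrite span_nil memv0 => /eqP ->; rewrite dot0r.
have [v1 v1K v1P] := IH v; have [w wK wP] := IH y.
have sub z : z \in <<vs>>%VS -> z \in <<v :: vs>>%VS.
  by move=> zK; rewrite span_cons; apply: (subvP (addvSr _ _)).
pose u := v - v1.
have vu : v = v1 + u by rewrite /u addrC subrK.
pose c := dot y u / dot u u.
have uo z : z \in <<vs>>%VS -> dot u z = 0 by apply: v1P.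
have cE : dot y u = c * dot u u.
  have [u0|u0] := eqVneq u 0; first by rewrite u0 !dot0r mulr0.
  by rewrite /c divfK // dot_eq0.
exists (w + c *: u).
  apply: memvD; [exact: sub | apply/memvZ/memvB; last exact: sub].
  by rewrite memv_span ?mem_head.
move=> z; rewrite span_cons => /memv_addP[_ /vlineP[a ->] [z' z'K ->]].
have z'0 : dot (y - (w + c *: u)) z' = 0.
  by rewrite opprD addrA dotBl wP // dotZl uo // mulr0 subr0.
rewrite dotDr z'0 addr0 dotZr vu dotDr.
have -> : dot (y - (w + c *: u)) v1 = 0.
  by rewrite opprD addrA dotBl wP // dotZl uo // mulr0 subr0.
by rewrite dotBl dotDl dotZl cE (dotC w) (uo w) // !add0r subrr mulr0.
Qed.

(** * MINRES *)

Section MinresTheory.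
Context {R : realType} {n : nat}.
Variables (B : 'M[R]_n) (b : 'cV[R]_n).
Local Notation K := (krylov B b).
Local Notation res := (residual B b).

(** The normal equations; c below is the minimizer of the squared residual norm on
    the line through s in the direction v. *)
Lemma minres_orthogonality t s v :
  minres_iterate B b t s -> v \in K t -> dot (res s) (B *m v) = 0.
Proof.
case=> sK smin vK; pose z := B *m v; pose y := B *m s + b.
have -> : res s = - y by rewrite /residual /y opprD.
have shift c : B *m (s + c *: v) + b = y + c *: z.
  by rewrite mulmxDr -scalemxAr addrAC.
have {}smin c : dot y y <= dot (y + c *: z) (y + c *: z).
  by rewrite -shift -!enorm_sqr smin // memvD ?memvZ.
rewrite -/z dotNl; apply/eqP; rewrite oppr_eq0; clearbody y z.
have [z0|z0] := eqVneq z 0; first by rewrite z0 dot0r.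
have zp : 0 < dot z z by rewrite dot_gt0.
pose c := - (dot y z / dot z z).
have := smin c; rewrite dotDl !dotDr !dotZl !dotZr (dotC z y) => h.
have : 0 <= c * (2 * dot y z + c * dot z z) by lra.
have -> : c * (2 * dot y z + c * dot z z) = - (dot y z ^+ 2 / dot z z).
  by rewrite /c; field; rewrite gt_eqF.
rewrite oppr_ge0 pmulr_lle0 ?invr_gt0 // => h2.
by rewrite -sqrf_eq0 eq_le h2 sqr_ge0.
Qed.

Lemma minres_iterate_exists t : exists s, minres_iterate B b t s.
Proof.
have [w wK wP] := orthogonal_decomposition [seq B *m v | v <- vbasis (K t)] (- b).
have span_img z : z \in <<[seq B *m v | v <- vbasis (K t)]>>%VS <->
    exists2 v, v \in K t & z = B *m v.
  pose F := linfun (mulmx B : 'cV[R]_n -> 'cV[R]_n).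
  have FE v : F v = B *m v by rewrite lfunE.
  have -> : [seq B *m v | v <- vbasis (K t)] = map F (vbasis (K t)).
    by apply: eq_map => v; rewrite FE.
  rewrite -limg_span (span_basis (vbasisP _)).
  split=> [/memv_imgP[v vK ->]|[v vK ->]]; first by exists v; rewrite ?FE.
  by rewrite -FE memv_img.
have /span_img[s sK wE] := wK.
exists s; split=> // s' s'K; rewrite !enorm_sqr.
have o : dot (B *m s + b) (B *m (s' - s)) = 0.
  rewrite -[LHS]opprK -dotNl opprD addrC -wE wP ?oppr0 //.
  by apply/span_img; exists (s' - s) => //; apply: memvB.
have -> : B *m s' + b = (B *m s + b) + B *m (s' - s).
  by rewrite mulmxBr [RHS]addrAC [in RHS](addrC (B *m s)) subrK.
move: (B *m s + b) (B *m (s' - s)) o => y z o.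
rewrite [leRHS]dotDl !dotDr (dotC z) o addr0 add0r.
by rewrite lerDl dot_ge0.
Qed.

Hypothesis Bsym : B^T = B.

(** Once K_(T+1) = K_T, the residual r lies in K_T and B r is orthogonal to itself,
    so B r = 0 and the solution test succeeds at the latest then. *)
Lemma minres_terminates eta vartheta : 0 <= eta ->
  exists t p D, minres B b eta vartheta t p D.
Proof.
move=> eta0.
have [s sP] := choice minres_iterate_exists.
pose r j := res (s j).
pose stop j := npc_test B vartheta (r j) || sol_test B eta (r j) (s j).
have [T KT] := krylov_stationary B b.
have stopT : exists j, stop j.
  exists T; apply/orP; right; rewrite /sol_test.
  have rK : r T \in K T by rewrite -KT krylov_residual //; case: (sP T).
  have BrK : B *m r T \in K T by rewrite -KT krylov_mulmx.
  have : dot (B *m r T) (B *m r T) = 0.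
    by rewrite -dot_mulmx_sym // (minres_orthogonality (sP T)).
  by rewrite /enorm => ->; rewrite sqrtr0 mulr_ge0 ?sqrtr_ge0.
case: (ex_minnP stopT) => j jstop jmin.
have before i : (i < j)%N -> ~~ npc_test B vartheta (r i) && ~~ sol_test B eta (r i) (s i).
  by move=> ij; rewrite -negb_or; apply/negP => /jmin; rewrite leqNgt ij.
exists j.+1; have [np|np] := boolP (npc_test B vartheta (r j)).
  by exists (r j), NPC, s; split.
exists (s j), SOL, s; split=> //.
by move: jstop; rewrite /stop (negPf np).
Qed.

Lemma minres_npc eta t r : minres B b eta 0 t r NPC ->
  [/\ r != 0, dot r (B *m r) <= 0 & dot b r = - dot r r].
Proof.
case=> s [t0 sP _ [np ->]]; case/andP: np => -> np.
rewrite mul0r in np; split=> //.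
have [sK _] := sP t.-1 ltac:(by rewrite prednK).
have := minres_orthogonality (sP t.-1 ltac:(by rewrite prednK)) sK.
set q := res _ => o; apply/eqP; rewrite -addr_eq0 -dotDl.
have -> : b + q = - (B *m s t.-1) by rewrite /q /residual addrC subrK.
by rewrite dotNl dotC o oppr0.
Qed.

(** The conjugate residual recursion.  The induction carries the MINRES iterate
    together with the next search direction p, which is B-conjugate to the
    previous Krylov space.  Both are nonnegative combinations of the residuals
    r_i = - b - B s_i, hence of the form - mu *: b + B w with mu >= 0; only this
    sign is kept.  It persists because the step length and the coefficient of
    the old direction in the new one are quotients of the positive quantities
    dot r_j (B r_j). *)
Lemma conjugate_residual_cone N (s : nat -> 'cV[R]_n) :
    (forall j, (j <= N)%N -> minres_iterate B b j (s j)) ->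
    (forall j, (j < N)%N -> 0 < dot (res (s j)) (B *m res (s j))) ->
    {in K N, forall v, B *m v = 0 -> v = 0} ->
  exists2 mu, 0 <= mu & exists2 w, w \in K N & s N = - mu *: b + B *m w.
Proof.
move=> sP rpos Binj; pose r j := res (s j).
suff /(_ N (leqnn N))[] : forall j, (j <= N)%N ->
    (exists2 mu, 0 <= mu & exists2 w, w \in K j & s j = - mu *: b + B *m w) /\
    ((j < N)%N -> exists p, [/\ p \in K j.+1,
        {in K j, forall v, dot (B *m p) (B *m v) = 0}, 0 < dot (r j) (B *m p)
      & exists2 lam, 0 <= lam & exists2 w, w \in K j & p = - lam *: b + B *m w]) by [].
elim=> [_|j IH jN].
  have s0 : s 0%N = 0.
    by apply/eqP; rewrite -(krylov0 B b); case: (sP 0%N (leq0n N)).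
  split; first by exists 0 => //; exists 0; rewrite ?mem0v // s0 oppr0 scale0r mulmx0 addr0.
  move=> N0; exists (r 0%N); split.
  - by rewrite krylov_residual // s0 mem0v.
  - by move=> v; rewrite krylov0 => /eqP ->; rewrite mulmx0 dot0r.
  - exact: rpos.
  exists 1 => //; exists 0; rewrite ?mem0v //.
  by rewrite /r /residual s0 !mulmx0 oppr0 add0r addr0 scaleN1r.
have [[mu mu0 [w wK sE]] /(_ jN)[p [pK po pp [lam lam0 [w' w'K pE]]]]] := IH (ltnW jN).
have sPj := sP j (ltnW jN); have sPj1 := sP j.+1 jN.
have Bp : 0 < dot (B *m p) (B *m p).
  rewrite dot_gt0; apply: contraTneq pp => ->; by rewrite dot0r ltxx.
pose al := dot (r j) (B *m p) / dot (B *m p) (B *m p).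
have al0 : 0 < al by rewrite divr_gt0.
have p_out : p \notin K j.
  by apply: contraTN pp => pKj; rewrite (minres_orthogonality sPj) // ltxx.
have sEj : s j.+1 = s j + al *: p.
  (* the conjugate residual update meets the optimality condition of the
     (unique) minimizer over the larger Krylov space *)
  apply/eqP; rewrite -subr_eq0; apply/eqP; set e := _ - _.
  have eK : e \in K j.+1.
    rewrite rpredB ?memvD ?memvZ //; first by case: sPj1.
    by apply: (subvP (krylovS B b j)); case: sPj.
  apply: Binj; first exact: (subvP (krylov_le B b jN)).
  have BeE : B *m e = (r j - al *: (B *m p)) - r j.+1.
    rewrite /e /r /residual mulmxBr mulmxDr -scalemxAr !opprD !opprK.
    by apply/matrixP => i k; rewrite !mxE; ring.
  have o v : v \in K j.+1 -> dot (r j - al *: (B *m p)) (B *m v) = 0.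
    move=> /(krylovS_exchange pK p_out)[u uK [c ->]].
    rewrite mulmxDr -scalemxAr dotDr dotZr !(dotBl (r j)) !dotZl po // mulr0.
    rewrite /r (minres_orthogonality sPj) // subrr add0r /al divfK ?gt_eqF //.
    by rewrite subrr mulr0.
  by apply/eqP; rewrite -dot_eq0 {1}BeE dotBl o // (minres_orthogonality sPj1) // subrr.
split.
  exists (mu + al * lam); first by rewrite addr_ge0 // mulr_ge0 // ltW.
  exists (w + al *: w'); first by apply: (subvP (krylovS B b j)); rewrite memvD ?memvZ.
  rewrite sEj {1}sE pE mulmxDr -scalemxAr.
  by apply/matrixP => i k; rewrite !mxE; ring.
move=> j1N; have rK : r j \in K j.+1 by rewrite krylov_residual //; case: sPj.
have rE : r j.+1 = r j - al *: (B *m p).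
  rewrite /r /residual sEj mulmxDr -scalemxAr.
  by apply/matrixP => i k; rewrite !mxE; ring.
have crossE : al * dot (B *m r j.+1) (B *m p) = - dot (r j.+1) (B *m r j.+1).
  have h := minres_orthogonality sPj1 rK.
  rewrite -dotZr -[al *: _](subKr (r j)) -rE dotBr -dot_mulmx_sym // h sub0r.
  by rewrite -dot_mulmx_sym.
pose be := - (dot (B *m r j.+1) (B *m p) / dot (B *m p) (B *m p)).
have be0 : 0 <= be.
  rewrite /be oppr_ge0 pmulr_lle0 ?invr_gt0 // -(pmulr_rle0 _ al0) crossE oppr_le0.
  by rewrite ltW // rpos.
exists (r j.+1 + be *: p); split.
- apply: memvD; first by rewrite krylov_residual //; case: sPj1.
  by apply/memvZ/(subvP (krylovS B b j.+1)).
- move=> v /(krylovS_exchange pK p_out)[u uK [c ->]].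
  rewrite mulmxDr -scalemxAr [B *m (_ + _ *: p)]mulmxDr -scalemxAr.
  rewrite !dotDl !dotDr !dotZl !dotZr (po u) // mulr0 add0r.
  rewrite -dot_mulmx_sym // (minres_orthogonality sPj1) ?krylov_mulmx // add0r.
  by rewrite /be; field; rewrite gt_eqF.
- rewrite mulmxDr -scalemxAr dotDr dotZr (minres_orthogonality sPj1 pK) mulr0 addr0.
  exact: rpos.
exists (1 + be * lam); first by rewrite addr_ge0 ?mulr_ge0.
exists (- s j.+1 + be *: w').
  apply: memvD; first by rewrite memvN; case: sPj1.
  by apply/memvZ/(subvP (krylovS B b j)).
rewrite pE /r /residual mulmxDr -scalemxAr mulmxN.
by apply/matrixP => i k; rewrite !mxE; ring.
Qed.

(** With s = - mu *: b + B w, the residual r is orthogonal to both B w and B s, so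
    that dot r s = mu * dot r r >= 0, and dot b s = - dot r s - dot s (B s).  The
    last conclusion bounds the residual by the solution test, since B is bounded
    below by sigma on the Krylov space that contains r. *)
Lemma minres_sol eta sigma t s : 0 < sigma -> 0 <= eta ->
    minres B b eta 0 t s SOL ->
    (forall v, v \in K t -> sigma * enorm v ^+ 2 <= dot v (B *m v)) ->
  [/\ dot b s <= - dot s (B *m s), sigma * enorm s ^+ 2 <= dot s (B *m s)
    & sigma * enorm (res s) <= eta * enorm (B *m s)].
Proof.
move=> sig0 eta0 [q [t0 qP nostop [np sol ->]]] hB.
have tE : (t.-1.+1 = t)%N by rewrite prednK.
set N := t.-1 in nostop np sol *.
have qPN j : (j <= N)%N -> minres_iterate B b j (q j) by move=> jN; apply: qP; rewrite -tE.
have KN v : v \in K N -> v \in K t by move=> vK; rewrite -tE (subvP (krylovS B b N)).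
have sK : q N \in K N by case: (qPN N (leqnn N)).
have rK : res (q N) \in K t by rewrite -tE krylov_residual.
have [||mu mu0 [w wK sE]] := conjugate_residual_cone qPN.
- move=> j jN; have := nostop j jN; rewrite /npc_test mul0r -ltNge negb_and negbK.
  case/andP => /orP[/eqP r0|]; last by rewrite -ltNge.
  by rewrite r0 mulmx0 enorm0 ltNge (mulr_ge0 eta0 (enorm_ge0 _)).
- move=> v /KN vK Bv; have := hB v vK; rewrite Bv dot0r pmulr_rle0 // => h.
  by apply/eqP; rewrite -enorm_eq0 -sqrf_eq0 eq_le h sqr_ge0.
have o := minres_orthogonality (qPN N (leqnn N)).
split; last 1 first.
- have [->|r0] := eqVneq (res (q N)) 0; first by rewrite enorm0 mulr0 mulr_ge0 ?enorm_ge0.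
  apply: le_trans sol.
  have rp : 0 < enorm (res (q N)) by rewrite lt_neqAle enorm_ge0 eq_sym enorm_eq0 r0.
  have := le_trans (hB _ rK) (dot_le _ _); rewrite expr2 mulrA [_ * enorm (B *m _)]mulrC.
  by rewrite ler_pM2r.
- set s' := q N in sE sK rK o *.
  have bE : b = - res s' - B *m s' by rewrite /residual opprD !opprK addrAC addrN add0r.
  have rs : dot (res s') s' = mu * dot (res s') (res s').
    rewrite {2}sE dotDr dotZr o // addr0 {2}bE dotBr dotNr o // subr0.
    by rewrite mulrNN.
  rewrite {1}bE dotBl dotNl rs (dotC (B *m s')) lerBlDr addrC subrr oppr_le0.
  by rewrite mulr_ge0 ?dot_ge0.
by apply/hB/KN.
Qed.

End MinresTheory.

(** * Derivatives along lines *)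

Lemma MVT_from0 {R : realType} (phi dphi : R -> R) (s : R) :
    (forall t : R, is_derive t (1 : R) phi (dphi t)) -> 0 < s ->
  exists2 c, 0 < c < s & phi s - phi 0 = dphi c * s.
Proof.
move=> dP s0.
have [|c] := @MVT R phi dphi 0 s s0 (fun t _ => dP t).
  by apply: derivable_within_continuous => t _; apply: ex_derive.
by rewrite in_itv /= subr0 => cs ->; exists c.
Qed.

Section AlongLines.
Context {R : realType} {d : nat}.
Implicit Types (g f : 'cV[R]_d -> R) (x y u v w : 'cV[R]_d).

(** The difference quotients of g along the line are those of its directional
    derivative. *)
Lemma is_derive_line g x v (t : R) :
  differentiable g (x + t *: v) ->
  is_derive t 1 (fun t => g (x + t *: v)) ('D_v g (x + t *: v)).
Proof.
move=> dg.
have quotE : (fun h : R => h^-1 *: (((fun t => g (x + t *: v)) \o shift t) (h *: 1)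
    - g (x + t *: v))) =
  (fun h : R => h^-1 *: ((g \o shift (x + t *: v)) (h *: v) - g (x + t *: v))).
  apply/funext => h /=; congr (_ *: (g _ - _)).
  by rewrite -[h *: 1]/(h * 1) mulr1 scalerDl addrCA.
split; last by rewrite /derive quotE.
by rewrite /derivable quotE; apply: diff_derivable.
Qed.

Lemma derive_coordE g x v : differentiable g x ->
  'D_v g x = \sum_j v j 0 * 'D_(delta_mx j 0) g x.
Proof.
move=> dg; rewrite deriveE // {1}[v]matrix_sum_delta linear_sum /=.
apply: eq_bigr => j _.
by rewrite big_ord1 linearZ /= deriveE.
Qed.

Lemma derive_grad f x v : differentiable f x -> 'D_v f x = dot (grad f x) v.
Proof.
move=> df; rewrite derive_coordE //; apply: eq_bigr => j _.
by rewrite mxE mulrC.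
Qed.

Lemma differentiable_grad_coord f x i :
  differentiable (grad f) x -> differentiable (fun y => grad f y i 0 : R) x.
Proof. move=> dg; apply: (@differentiable_comp _ _ _ _ (grad f)
  (fun N : 'cV[R]_d => N i 0 : R)) => //; exact: differentiable_coord. Qed.

Lemma derive_hess f x v i : differentiable (grad f) x ->
  'D_v (fun y => grad f y i 0 : R) x = (hess f x *m v) i 0.
Proof.
move=> /(differentiable_grad_coord i) dg; rewrite derive_coordE // mxE.
by apply: eq_bigr => j _; rewrite mxE mulrC.
Qed.

Lemma is_derive_dot_grad f w x v (t : R) : differentiable (grad f) (x + t *: v) ->
  is_derive t 1 (fun t => dot w (grad f (x + t *: v)))
    (dot w (hess f (x + t *: v) *m v)).
Proof.
move=> dg.
have -> : (fun t => dot w (grad f (x + t *: v))) =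
    \sum_i (w i 0 \*: (fun t => grad f (x + t *: v) i 0 : R)).
  by apply/funext => s; rewrite fct_sumE.
apply: is_derive_sum => i; apply: is_deriveZ.
apply: is_derive_eq (is_derive_line (differentiable_grad_coord i dg)) _.
exact: derive_hess.
Qed.

End AlongLines.

(** * Second-order calculus on the orthant *)

Section Taylor.
Context {R : realType} {d : nat}.
Variable f : 'cV[R]_d -> R.
Hypothesis fC2 : C2 f.
Implicit Types (x y u v w p : 'cV[R]_d).

Lemma is_derive_f_line x v (t : R) :
  is_derive t 1 (fun t => f (x + t *: v)) (dot (grad f (x + t *: v)) v).
Proof.
have [df _ _] := fC2.
by apply: is_derive_eq (is_derive_line (df _)) _; apply: derive_grad.
Qed.

(** The mean value theorem, first in direction i for the difference in
    direction j, then in direction j for the i-th partial derivative. *)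
Lemma second_difference x (i j : 'I_d) (s : R) : 0 < s ->
  let u := delta_mx i 0 in let v := delta_mx j 0 in
  exists c1 c2, [/\ 0 < c1 < s, 0 < c2 < s &
    f (x + s *: u + s *: v) - f (x + s *: u) - f (x + s *: v) + f x =
    s ^+ 2 * hess f (x + c1 *: u + c2 *: v) i j].
Proof.
move=> s0 u v; have [df dg _] := fC2.
pose F t := f (x + s *: v + t *: u) - f (x + t *: u).
have gE y : dot (grad f y) u = grad f y i 0.
  by rewrite -derive_grad // mxE.
have dF (t : R) : is_derive t 1 F (grad f (x + s *: v + t *: u) i 0 - grad f (x + t *: u) i 0).
  by rewrite -!gE; apply: is_deriveB; apply: is_derive_f_line.
have [c1 c1s Fs] := MVT_from0 dF s0.
have dG (t : R) := is_derive_line (differentiable_grad_coord i (dg (x + c1 *: u + t *: v))).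
have [c2 c2s Gs] := MVT_from0 dG s0.
exists c1, c2; split=> //.
have <- : 'D_v (fun y => grad f y i 0 : R) (x + c1 *: u + c2 *: v) =
          hess f (x + c1 *: u + c2 *: v) i j by rewrite [RHS]mxE.
move: Fs; rewrite /F !scale0r !addr0 (addrAC x (s *: v)) => Fs.
move: Gs; rewrite scale0r addr0 => Gs.
by rewrite (addrAC x (s *: v)) Gs in Fs; rewrite expr2 [RHS]mulrC mulrA -Fs; ring.
Qed.

(** The second difference is symmetric in the two directions; it evaluates the
    entries (i, j) and (j, i) at two points that tend to x with s. *)
Lemma hess_sym x : (hess f x)^T = hess f x.
Proof.
apply/matrixP => j i; rewrite mxE; apply/eqP; rewrite -subr_eq0 -normr_le0.
apply/ler_addgt0Pr => e e0; rewrite add0r.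
have [_ _ ch] := fC2.
have near_x k l : exists2 r : R, 0 < r & forall y, `|x - y| < r ->
    `|hess f x k l - hess f y k l| < e / 2.
  have /cvgrPdist_lt : (fun y => hess f y k l : R) @ x --> (hess f x k l : R).
    apply: (@continuous_comp _ _ _ (hess f) (fun A : 'M[R]_d => A k l : R)).
      exact: ch.
    exact: coord_continuous.
  move=> /(_ (e / 2) ltac:(by rewrite divr_gt0)) /nbhs_normP[r /= r0 hr].
  by exists r.
have [r1 r10 h1] := near_x i j; have [r2 r20 h2] := near_x j i.
pose u : 'cV[R]_d := delta_mx i 0; pose v : 'cV[R]_d := delta_mx j 0.
pose N := `|u| + `|v| + 1.
have N0 : 0 < N by rewrite ltr_wpDl ?addr_ge0.
pose s := Num.min r1 r2 / N.
have s0 : 0 < s by rewrite divr_gt0 // lt_min r10.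
have close c1 c2 r : Num.min r1 r2 <= r -> 0 < c1 < s -> 0 < c2 < s ->
    `|x - (x + (c1 *: u + c2 *: v))| < r.
  move=> sr /andP[c10 c1s] /andP[c20 c2s]; apply: lt_le_trans sr.
  rewrite opprD addrA subrr add0r normrN (le_lt_trans (ler_normD _ _)) // !normrZ.
  rewrite !gtr0_norm // (_ : Num.min r1 r2 = s * N); last by rewrite divfK ?gt_eqF.
  have := normr_ge0 u; have := normr_ge0 v; rewrite /N.
  move: `|u| `|v| => a b; nra.
have [c1 [c2 [c1s c2s E1]]] := second_difference x i j s0.
have [c3 [c4 [c3s c4s E2]]] := second_difference x j i s0.
rewrite -/u -/v in E1 E2.
have sn0 : s ^+ 2 != 0 by rewrite expf_neq0 // gt_eqF.
have Yr1 : `|x - (x + (c1 *: u + c2 *: v))| < r1 by apply: close; rewrite ?ge_min ?lexx.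
have Zr2 : `|x - (x + (c4 *: u + c3 *: v))| < r2.
  by apply: close; rewrite ?ge_min ?lexx ?orbT.
rewrite -(addrA x (c1 *: u)) in E1; rewrite -(addrA x (c3 *: v)) (addrC (c3 *: v)) in E2.
move: (h1 _ Yr1) (h2 _ Zr2) E1 E2 => {h1 h2 close Yr1 Zr2}.
move: (hess f (x + _)) (hess f (x + _)) => HZ HY.
move: (hess f x) => H H1 H2 E1 E2.
have EE : HY i j = HZ j i.
  apply: (mulfI sn0); rewrite -E1 -E2 (addrAC x (s *: v)).
  by congr (_ + _); exact: addrAC.
rewrite EE in H1.
rewrite (_ : H i j - _ = (H i j - HZ j i) - (H j i - HZ j i)); last first.
  by rewrite opprB addrA subrK.
by rewrite (le_trans (ler_normB _ _)) //; lra.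
Qed.

Variables Lg LH : R.
Hypotheses (Lg_ge0 : 0 <= Lg) (LH_ge0 : 0 <= LH).
Hypothesis grad_lip : forall x y, nonneg x -> nonneg y ->
  enorm (grad f x - grad f y) <= Lg * enorm (x - y).
Hypothesis hess_lip : forall x y, nonneg x -> nonneg y ->
  opnorm (hess f x - hess f y) <= LH * enorm (x - y).

Lemma nonneg_segment x p (t : R) : nonneg x -> nonneg (x + p) -> 0 <= t <= 1 ->
  nonneg (x + t *: p).
Proof.
move=> /forallP x0 /forallP xp0 /andP[t0 t1]; apply/forallP => i.
have := x0 i; have := xp0 i; rewrite !mxE.
by move: (x i 0) (p i 0) => a c ? ?; nra.
Qed.

Lemma grad_variation x p (t : R) w : nonneg x -> nonneg (x + p) -> 0 <= t <= 1 ->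
  dot w (grad f (x + t *: p)) <= dot w (grad f x) + enorm w * (Lg * t * enorm p).
Proof.
move=> x0 xp0 t01; have [t0 _] := andP t01.
rewrite -lerBlDl -dotBr (le_trans (dot_le _ _)) // ler_wpM2l ?enorm_ge0 //.
rewrite (le_trans (grad_lip (nonneg_segment x0 xp0 t01) x0)) //.
by rewrite addrAC subrr add0r enormZ ger0_norm // mulrA.
Qed.

Lemma hess_variation x p (t : R) u v :
    nonneg x -> nonneg (x + p) -> 0 <= t <= 1 ->
  dot u (hess f (x + t *: p) *m v) <=
  dot u (hess f x *m v) + LH * enorm p * enorm u * enorm v.
Proof.
move=> x0 xp0 t01; have [t0 t1] := andP t01.
rewrite -lerBlDl -dotBr -mulmxBl (le_trans (dot_le _ _)) //.
rewrite [_ * enorm u]mulrC -(mulrA (enorm u)).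
rewrite ler_wpM2l ?enorm_ge0 // (le_trans (enorm_mulmx_le _ _)) //.
rewrite ler_wpM2r ?enorm_ge0 //.
rewrite (le_trans (hess_lip (nonneg_segment x0 xp0 t01) x0)) // ler_wpM2l //.
by rewrite addrAC subrr add0r enormZ ger0_norm // ler_piMl ?enorm_ge0.
Qed.

(** The mean value theorem suffices: the sharp constant Lg / 2 would only improve
    the final constant. *)
Lemma first_order_bound x p : nonneg x -> nonneg (x + p) ->
  f (x + p) - f x <= dot (grad f x) p + Lg * enorm p ^+ 2.
Proof.
move=> x0 xp0.
have [c /andP[c0 c1]] := MVT_from0 (is_derive_f_line x p) (@ltr01 R).
rewrite scale1r scale0r addr0 mulr1 => ->.
rewrite dotC (dotC (grad f x)).
have := grad_variation p x0 xp0 (t := c); rewrite (ltW c0) (ltW c1) => /(_ isT).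
move/le_trans; apply; rewrite lerD2l.
have := enorm_ge0 p; move: (enorm p) => N N0.
have : 0 <= Lg * N ^+ 2 by rewrite mulr_ge0 ?sqr_ge0.
nra.
Qed.

Lemma grad_second_order x p w : nonneg x -> nonneg (x + p) ->
  dot w (grad f (x + p)) <=
  dot w (grad f x) + dot w (hess f x *m p) + LH * enorm p ^+ 2 * enorm w.
Proof.
move=> x0 xp0.
have dG (t : R) := @is_derive_dot_grad _ _ f w x p t
  (let: And3 _ dg _ := fC2 in dg (x + t *: p)).
have [c /andP[c0 c1]] := MVT_from0 dG (@ltr01 R).
rewrite scale1r scale0r addr0 mulr1 => /eqP; rewrite subr_eq => /eqP ->.
rewrite addrC -addrA lerD2l.
have := hess_variation w p x0 xp0 (t := c); rewrite (ltW c0) (ltW c1) => /(_ isT).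
by rewrite expr2 (mulrA LH) (mulrAC (LH * enorm p) (enorm p)).
Qed.

(** The mean value theorem for the scalar function dot w (grad f), where w is the
    remainder itself. *)
Lemma enorm_grad_second_order x p : nonneg x -> nonneg (x + p) ->
  enorm (grad f (x + p) - grad f x - hess f x *m p) <= LH * enorm p ^+ 2.
Proof.
move=> x0 xp0; set w := _ - _ - _.
have := grad_second_order w x0 xp0.
rewrite -addrA -lerBlDl -dotBr -lerBlDl -dotBr -/w -enorm_sqr expr2.
have [->|w0] := eqVneq (enorm w) 0; first by rewrite mulr_ge0 ?sqr_ge0.
by rewrite ler_pM2r // lt_neqAle enorm_ge0 eq_sym w0.
Qed.

(** Here the factor 1 / 2 of the curvature matters: it is what makes the unit step
    acceptable for every rho < 1 / 2.  The difference of both sides, as a function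
    of the position on the segment, has a nonpositive derivative. *)
Lemma second_order_bound x p : nonneg x -> nonneg (x + p) ->
  f (x + p) - f x <=
  dot (grad f x) p + (dot p (hess f x *m p) + LH * enorm p ^+ 3) / 2.
Proof.
move=> x0 xp0; set M := _ + LH * _.
pose psi (t : R) := f (x + t *: p) - (dot (grad f x) p * t + M / 2 * t ^+ 2).
have dpsi (t : R) : is_derive t (1 : R) psi
    (dot (grad f (x + t *: p)) p - (dot (grad f x) p + M * t)).
  apply: is_deriveB; first exact: is_derive_f_line.
  have -> : (fun t : R => dot (grad f x) p * t + M / 2 * t ^+ 2) =
      horner ((dot (grad f x) p)%:P * 'X + (M / 2)%:P * 'X^2).
    by apply/funext => s; rewrite !hornerE.
  apply: is_derive_eq (is_derive_poly _ _) _.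
  rewrite derivD !deriv_mulC derivX derivXn !hornerE /=; by field.
have [c /andP[c0 c1]] := MVT_from0 dpsi (@ltr01 R).
rewrite /psi scale1r scale0r addr0 expr0n expr1n /= !mulr0 !mulr1 addr0 subr0 => E.
rewrite -subr_le0 [leLHS](_ : _ = f (x + p) - (dot (grad f x) p + M / 2) - f x); last first.
  by rewrite addrAC.
rewrite E subr_le0 dotC (dotC (grad f x)).
have c01 : 0 <= c <= 1 by rewrite !ltW.
have xcp := nonneg_segment x0 xp0 c01.
have := grad_second_order p x0 xcp.
rewrite enormZ gtr0_norm // -scalemxAr dotZr => /le_trans; apply.
rewrite -addrA lerD2l /M exprMn mulrDl.
rewrite mulrC lerD2l.
have := enorm_ge0 p; move: (enorm p) => N N0.
have Q0 : 0 <= LH * N ^+ 3 * c by rewrite !mulr_ge0 ?exprn_ge0 // ltW.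
rewrite [leLHS](_ : _ = LH * N ^+ 3 * c * c); last by ring.
by rewrite ler_piMr // ltW.
Qed.

(** The Lipschitz constant of the gradient bounds the Hessian only in directions
    that stay in the orthant for a short time.  The mean value theorem gives the
    bound at a point close to x, and the Hessian varies little in between. *)
Lemma hess_bound x v (tau : R) : nonneg x -> 0 < tau -> nonneg (x + tau *: v) ->
  enorm (hess f x *m v) <= Lg * enorm v.
Proof.
move=> x0 tau0 xt0; set w := hess f x *m v.
suff : dot w w <= enorm w * (Lg * enorm v).
  rewrite -enorm_sqr expr2.
  have [->|w0] := eqVneq (enorm w) 0; first by rewrite mulr_ge0 ?enorm_ge0.
  by rewrite ler_pM2l // lt_neqAle enorm_ge0 eq_sym w0.
apply/ler_addgt0Pr => e e0.
pose Q := LH * enorm v * enorm w * enorm v.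
have Q0 : 0 <= Q by rewrite !mulr_ge0 ?enorm_ge0.
pose s := Num.min tau (e / (Q + 1)).
have s0 : 0 < s by rewrite lt_min tau0 divr_gt0 // ltr_wpDl.
have sQ : s * Q <= e.
  have : s <= e / (Q + 1) by rewrite ge_min lexx orbT.
  rewrite ler_pdivlMr ?ltr_wpDl // => h; apply: le_trans h.
  by rewrite ler_wpM2l ?(ltW s0) // lerDl.
have xs0 : nonneg (x + s *: v).
  have -> : s *: v = (s / tau) *: (tau *: v) by rewrite scalerA divfK ?gt_eqF.
  apply: nonneg_segment => //; rewrite divr_ge0 ?(ltW tau0) ?(ltW s0) //=.
  by rewrite ler_pdivrMr // mul1r ge_min lexx.
have dG (t : R) := @is_derive_dot_grad _ _ f w x v t
  (let: And3 _ dg _ := fC2 in dg (x + t *: v)).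
have [c /andP[c0 cs] E] := MVT_from0 dG s0.
have xc0 : nonneg (x + c *: v).
  have -> : c *: v = (c / s) *: (s *: v) by rewrite scalerA divfK ?gt_eqF.
  apply: nonneg_segment => //; rewrite divr_ge0 ?(ltW c0) ?(ltW s0) //=.
  by rewrite ler_pdivrMr // mul1r ltW.
have t11 : 0 <= (1 : R) <= 1 by rewrite ler01 lexx.
have t00 : 0 <= (0 : R) <= 1 by rewrite lexx ler01.
have H1 : dot w (hess f (x + c *: v) *m v) <= enorm w * (Lg * enorm v).
  rewrite -(ler_pM2l s0) mulrC -E scale0r addr0 lerBlDl.
  have := grad_variation w x0 xs0 t11; rewrite scale1r enormZ gtr0_norm //.
  by rewrite mulr1 [s * (enorm w * _)]mulrCA (mulrCA s Lg).
apply: le_trans (lerD H1 (le_refl e)).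
have xcm : nonneg (x + c *: v + (- (c *: v))) by rewrite addrK.
have := hess_variation w v xc0 xcm t11; rewrite scale1r addrK enormN enormZ gtr0_norm //.
rewrite -/w => /le_trans; apply; rewrite lerD2l; apply: le_trans sQ.
rewrite /Q !mulrA; do 3 (rewrite ler_wpM2r ?enorm_ge0 //).
by rewrite mulrC ler_wpM2r // ltW.
Qed.

End Taylor.

(** * Line searches *)

Section LineSearchTheory.
Context {R : realType}.
Variables (crit : R -> bool) (zeta : R).
Hypothesis zeta01 : 0 < zeta < 1.

Let zeta_gt0 : 0 < zeta. Proof. by case/andP: zeta01. Qed.
Let zeta_lt1 : zeta < 1. Proof. by case/andP: zeta01. Qed.
Let zeta_neq0 : zeta != 0. Proof. by rewrite gt_eqF. Qed.

Lemma geometric_small (a : R) : 0 < a -> exists m, zeta ^+ m <= a.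
Proof.
move=> a0.
have /cvgrPdist_le/(_ _ a0)[m _ /(_ m (leqnn m))] : zeta ^+ n @[n --> \oo] --> 0.
  by apply: cvg_expr; rewrite gtr0_norm.
by rewrite sub0r normrN ger0_norm ?exprn_ge0 ?(ltW zeta_gt0) // => h; exists m.
Qed.

(** All that the analysis uses of the search: the accepted step, and the rejected
    step preceding it, if any. *)
Lemma backtrackingP alpha : backtracking crit zeta alpha ->
  [/\ crit alpha, 0 < alpha, crit 1 -> alpha = 1
    & alpha = 1 \/ alpha / zeta <= 1 /\ ~~ crit (alpha / zeta)].
Proof.
case=> -[|m] [-> cm h]; first by split=> //; left.
split=> //; first by rewrite exprn_gt0.
  by move=> c1; have := h 0%N isT; rewrite expr0 c1.
right; rewrite exprSr mulfK //; split; last exact: h.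
by rewrite exprn_ile1 // ltW.
Qed.

(** Unlike backtracking, this search always meets a rejected step, namely
    alpha / zeta in both phases. *)
Lemma forward_backwardP alpha : forward_backward crit zeta alpha ->
  [/\ crit alpha, 0 < alpha, ~~ crit (alpha / zeta)
    & 1 <= alpha \/ alpha / zeta <= 1].
Proof.
rewrite /forward_backward; case: ifP => c1.
  case=> -[|m] [-> cm h]; first by rewrite expr0 invr1 c1 in cm.
  have E : zeta * zeta ^- m.+1 = zeta ^- m.
    by rewrite exprS invfM mulrA divff // mul1r.
  have zm : 0 < zeta ^- m by rewrite invr_gt0 exprn_gt0.
  rewrite E; split=> //; first exact: h.
    by rewrite -E mulrC mulrA mulVf // mul1r.
  by left; rewrite invf_ge1 ?exprn_gt0 // exprn_ile1 // ltW.
by move/backtrackingP => [ca a0 _ [a1|[]]]; [rewrite a1 c1 in ca|split=> //; right].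
Qed.

Lemma backtracking_exists (a : R) : 0 < a -> (forall t, 0 < t <= a -> crit t) ->
  exists alpha, backtracking crit zeta alpha.
Proof.
move=> a0 ca; have [n zn] := geometric_small a0.
have ex : exists m, crit (zeta ^+ m) by exists n; rewrite ca // exprn_gt0.
case: (ex_minnP ex) => m cm minm; exists (zeta ^+ m), m; split=> // j jm.
by apply/negP => /minm; rewrite leqNgt jm.
Qed.

Lemma forward_backward_exists (a b : R) : 0 < a -> (forall t, 0 < t <= a -> crit t) ->
    (forall t, crit t -> t <= b) ->
  exists alpha, forward_backward crit zeta alpha.
Proof.
move=> a0 ca cb; have [c1|/negbTE c1] := boolP (crit 1); last first.
  have [alpha al] := backtracking_exists a0 ca.
  by exists alpha; rewrite /forward_backward c1.
have b0 : 0 < b by apply: lt_le_trans (cb _ c1).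
have [n zn] := geometric_small (a := (b + 1)^-1) ltac:(by rewrite invr_gt0 addr_gt0).
have ex : exists m, ~~ crit (zeta ^- m).
  exists n; apply/negP => /cb; rewrite leNgt; apply/negP/negPn.
  apply: (@lt_le_trans _ _ (b + 1)); first by rewrite ltrDl.
  by rewrite -[b + 1]invrK lef_pV2 // posrE ?exprn_gt0 ?invr_gt0 ?addr_gt0.
case: (ex_minnP ex) => m cm minm; exists (zeta * zeta ^- m).
rewrite /forward_backward c1; exists m; split=> // j jm.
by apply: contraTT jm => /minm; rewrite -leqNgt.
Qed.

End LineSearchTheory.

(** * One projected gradient coordinate *)

Lemma projected_step_bound {R : realType} (x g alpha : R) : 0 <= x -> 0 < alpha ->
  alpha * (g * (Num.max (x - alpha * g) 0 - x)) <= - (Num.max (x - alpha * g) 0 - x) ^+ 2.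
Proof.
move=> x0 a0; have [h|h] := leP (x - alpha * g) 0; last first.
  by rewrite addrAC subrr add0r; nra.
by rewrite sub0r; nra.
Qed.

(** A coordinate that is not projected contributes alpha * g ^+ 2, a projected one
    x * g.  As x <= e, the former dominates the squared defect (x * g) ^+ 2 of
    condition (b), divided by e ^+ 2, and so does the latter while
    x * g <= e ^+ 2; beyond, it exceeds e ^+ 2, whence the truncation. *)
Lemma projected_step_decrease {R : realType} (x g alpha a e : R) :
    0 <= x <= e -> 0 < a -> a <= alpha -> a <= 1 ->
  a * Num.min ((x * g) ^+ 2) (e ^+ 2 * e ^+ 2) <=
  e ^+ 2 * - (g * (Num.max (x - alpha * g) 0 - x)).
Proof.
move=> /andP[x0 xe] a0 aal a1.
have xxe : x ^+ 2 <= e ^+ 2 by rewrite ler_sqr ?nnegrE // (le_trans x0).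
have [h|h] := leP (x - alpha * g) 0; last first.
  apply: (@le_trans _ _ (alpha * (x ^+ 2 * g ^+ 2))).
    apply: ler_pM => //; [exact: ltW | by rewrite le_min sqr_ge0 mulr_ge0 ?sqr_ge0 |].
    by rewrite ge_min exprMn lexx.
  rewrite addrAC subrr add0r !mulrN opprK.
  rewrite [leRHS](_ : _ = alpha * (e ^+ 2 * g ^+ 2)); last by ring.
  rewrite ler_wpM2l ?(le_trans (ltW a0)) //.
  by rewrite ler_wpM2r ?sqr_ge0.
rewrite sub0r [g * _]mulrN opprK (mulrC g).
have g0 : 0 <= x * g.
  have : 0 <= alpha * g by lra.
  by rewrite pmulr_rge0 ?(lt_le_trans a0) // => ?; rewrite mulr_ge0.
apply: (@le_trans _ _ (Num.min ((x * g) ^+ 2) (e ^+ 2 * e ^+ 2))).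
  by rewrite ler_piMl // le_min sqr_ge0 mulr_ge0 ?sqr_ge0.
have [yle|ygt] := leP (x * g) (e ^+ 2).
  by rewrite ge_min expr2 ler_wpM2r.
by rewrite ge_min [X in _ || X]ler_wpM2l ?orbT ?sqr_ge0 // ltW.
Qed.

(** * One iteration of the algorithm *)

Section Step.
Context {R : realType} {d : nat}.
Variables (f : 'cV[R]_d -> R) (eps_g theta rho zeta sigma omega Lg LH fstar : R).
Hypothesis eps01 : 0 < eps_g < 1.
Hypothesis fC2 : C2 f.
Hypotheses (Lg_ge0 : 0 <= Lg) (LH_ge0 : 0 <= LH).
Hypotheses (sigma_gt0 : 0 < sigma) (omega_gt0 : 0 < omega) (theta_gt0 : 0 < theta).
Hypotheses (rho01 : 0 < rho < 1 / 2) (zeta01 : 0 < zeta < 1).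
Hypothesis grad_lip : forall x y, nonneg x -> nonneg y ->
  enorm (grad f x - grad f y) <= Lg * enorm (x - y).
Hypothesis hess_lip : forall x y, nonneg x -> nonneg y ->
  opnorm (hess f x - hess f y) <= LH * enorm (x - y).
Hypothesis f_bounded : forall x, nonneg x -> fstar <= f x.

(* mu is the slope constant of MINRES directions; kap is small enough for all step
   size and length thresholds at once. *)
Variables mu kap : R.
Hypotheses (kap_gt0 : 0 < kap) (kap_mu : kap <= mu) (mu1 : mu <= 1) (mu_sigma : mu <= sigma)
  (kap_omega : kap <= omega) (kap_Lg : Lg * kap <= (1 - rho) * mu)
  (kap_LH : LH * kap <= (1 - 2 * rho) * sigma)
  (kap_npc : LH * kap <= 2 * (1 - rho) * omega)
  (kap_grad : (theta * Lg + sigma * LH) * kap <= sigma).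

Local Notation e := (Num.sqrt eps_g).
Local Notation A x := (active x (Num.sqrt eps_g)).
Local Notation I x := (inactive x (Num.sqrt eps_g)).
Implicit Types (x y u v p : 'cV[R]_d) (alpha : R).

Let e_gt0 : 0 < e. Proof. by rewrite sqrtr_gt0; case/andP: eps01. Qed.
Let e_sqr : e ^+ 2 = eps_g. Proof. by rewrite sqr_sqrtr // ltW //; case/andP: eps01. Qed.
Let e_le1 : e <= 1.
Proof. by rewrite -sqrtr1 ler_wsqrtr // ltW //; case/andP: eps01. Qed.
Let rho_gt0 : 0 < rho. Proof. by case/andP: rho01. Qed.
Let rho_lt : rho < 1 / 2. Proof. by case/andP: rho01. Qed.
Let zeta_gt0 : 0 < zeta. Proof. by case/andP: zeta01. Qed.
Let zeta_lt1 : zeta < 1. Proof. by case/andP: zeta01. Qed.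
Let mu_gt0 : 0 < mu. Proof. exact: lt_le_trans kap_mu. Qed.
Let kap1 : kap <= 1. Proof. exact: le_trans mu1. Qed.

Lemma nonneg_coord x i : nonneg x -> 0 <= x i 0.
Proof. by move/forallP. Qed.

Lemma nonneg_proj x : nonneg (Defs.proj x).
Proof. by apply/forallP => i; rewrite mxE le_max lexx orbT. Qed.

Lemma activeE x : nonneg x -> A x = ~: I x.
Proof. by move=> x0; apply/setP => i; rewrite !inE nonneg_coord // -leNgt. Qed.

Lemma submat_sym (S : {set 'I_d}) (H : 'M[R]_d) : H^T = H -> (submat S H)^T = submat S H.
Proof. by move=> Hs; apply/matrixP => i j; rewrite !mxE -[in LHS]Hs mxE. Qed.

Lemma dot_active_inactive x u v : nonneg x ->
  dot u v = dot (subvec (A x) u) (subvec (A x) v) + dot (subvec (I x) u) (subvec (I x) v).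
Proof. by move=> x0; rewrite (dot_split (I x)) addrC activeE. Qed.

(** The properties of a MINRES direction on which the analysis rests, separated
    from the run that produced it.  They hold trivially when the inactive set is
    empty and the flag is [SOL]. *)
Definition inactive_descent x p (D : minres_flag) : Prop :=
  let g := subvec (I x) (grad f x) in
  let H := submat (I x) (hess f x) in
  let s := subvec (I x) p in
  match D with
  | NPC => [/\ s != 0, dot s (H *m s) <= 0, dot g s = - dot s s
             & omega * enorm g <= enorm s]
  | SOL => [/\ dot g s <= - dot s (H *m s), sigma * dot s s <= dot s (H *m s)
             & sigma * enorm (H *m s + g) <= e * theta * enorm (H *m s)]
  end.

Definition active_direction x p : Prop :=
  subvec (A x) p = if typeI f eps_g x then - subvec (A x) (grad f x) else 0.

Lemma inactive_slope x p D : inactive_descent x p D ->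
  mu * enorm (subvec (I x) p) ^+ 2 <= - dot (subvec (I x) (grad f x)) (subvec (I x) p).
Proof.
rewrite enorm_sqr; have := dot_ge0 (subvec (I x) p) => q0.
case: D => [[_ _ -> _]|[h1 h2 _]]; first by rewrite opprK ler_piMl.
by rewrite lerNr (le_trans h1) // lerN2 (le_trans _ h2) // ler_wpM2r.
Qed.

Lemma crit_dE x p alpha : line_search_crit f eps_g rho x p alpha =
  (f (Defs.proj (x + alpha *: p)) - f x <=
    rho * dot (subvec (A x) (grad f x)) (subvec (A x) (Defs.proj (x + alpha *: p) - x))
    + alpha * rho * dot (subvec (I x) (grad f x)) (subvec (I x) p)).
Proof. by rewrite /line_search_crit subvecB subvec_proj subvecD subvecZ. Qed.

Lemma small_step_coord x p alpha i : 0 <= alpha ->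
  alpha * enorm (subvec (I x) p) <= e -> i \in I x -> 0 <= x i 0 + alpha * p i 0.
Proof.
move=> a0 h iI; have xi : e < x i 0 by move: iI; rewrite inE.
have : `|p i 0| <= enorm (subvec (I x) p).
  rewrite -ler_sqr ?nnegrE ?enorm_ge0 // enorm_sqr dot_subvec (bigD1 i) //=.
  rewrite real_normK ?num_real // expr2 lerDl sumr_ge0 // => j _.
  by rewrite -expr2 sqr_ge0.
move/(ler_wpM2l a0)/le_trans/(_ h) => h2.
have : - (alpha * `|p i 0|) <= alpha * p i 0.
  by rewrite -mulrN ler_wpM2l // lerNl -normrN ler_norm.
lra.
Qed.

Lemma small_step_inactive x p alpha : 0 <= alpha ->
    alpha * enorm (subvec (I x) p) <= e ->
  subvec (I x) (Defs.proj (x + alpha *: p) - x) = alpha *: subvec (I x) p.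
Proof.
move=> a0 h; rewrite -subvecZ; apply/subvec_eqP => i iI; rewrite !mxE.
have := small_step_coord a0 h iI => h2.
by rewrite max_l // addrAC subrr add0r.
Qed.

Lemma active_coord x p alpha i : nonneg x -> active_direction x p -> i \in A x ->
  Defs.proj (x + alpha *: p) i 0 - x i 0 =
  if typeI f eps_g x then Num.max (x i 0 - alpha * grad f x i 0) 0 - x i 0 else 0.
Proof.
move=> x0 pA iA; rewrite !mxE; move: pA; rewrite /active_direction.
case: ifP => _.
  have -> : - subvec (A x) (grad f x) = subvec (A x) (- grad f x).
    by apply/matrixP => j k; rewrite !mxE.
  by move/subvec_eqP => /(_ i iA) ->; rewrite !mxE mulrN.
move/subvec_eq0P => /(_ i iA) ->; rewrite mulr0 addr0 max_l ?subrr //.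
exact: nonneg_coord.
Qed.

Lemma active_slope x p alpha : nonneg x -> active_direction x p -> 0 < alpha ->
  alpha * dot (subvec (A x) (grad f x)) (subvec (A x) (Defs.proj (x + alpha *: p) - x))
  <= - enorm (subvec (A x) (Defs.proj (x + alpha *: p) - x)) ^+ 2.
Proof.
move=> x0 pA a0; rewrite enorm_sqr !dot_subvec mulr_sumr -sumrN.
apply: ler_sum => i iA.
have -> : (Defs.proj (x + alpha *: p) - x) i 0 = Defs.proj (x + alpha *: p) i 0 - x i 0.
  by rewrite !mxE.
rewrite active_coord //; case: ifP => _; last by rewrite !mulr0 oppr0.
by rewrite -expr2 projected_step_bound // nonneg_coord.
Qed.

(** In both types the active displacement a satisfies alpha * dot g a <= - dot a a,
    and the inactive one has slope at most - mu * q ^+ 2; for alpha * Lg at most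
    (1 - rho) * mu, these absorb the quadratic term of the first-order bound. *)
Lemma crit_first_order x p D alpha : nonneg x -> active_direction x p ->
    inactive_descent x p D -> 0 < alpha <= kap ->
    alpha * enorm (subvec (I x) p) <= e ->
  line_search_crit f eps_g rho x p alpha.
Proof.
move=> x0 pA pI /andP[a0 ak] aq; rewrite crit_dE.
have sI := inactive_slope pI; have sA := active_slope x0 pA a0.
have eI := small_step_inactive (ltW a0) aq.
set y := Defs.proj _ in sA eI *.
have xy : x + (y - x) = y by rewrite addrC subrK.
have := @first_order_bound _ _ f fC2 Lg Lg_ge0 grad_lip x (y - x).
rewrite xy => /(_ x0 (nonneg_proj _)).
rewrite enorm_sqr !(dot_active_inactive _ _ x0) eI -enorm_sqr dotZr dotZl dotZr -enorm_sqr.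
move: sI sA; move: (f y - f x) => F.
set q := enorm (subvec (I x) p); set b := enorm (subvec (A x) (y - x)).
set a := dot (subvec (A x) _) _; set c := dot _ (subvec (I x) p).
move=> sI sA /le_trans; apply; rewrite -subr_ge0 -(pmulr_rge0 _ a0).
have LA : Lg * alpha <= (1 - rho) * mu by rewrite (le_trans _ kap_Lg) // ler_wpM2l.
have S0 : 0 <= b ^+ 2 + alpha ^+ 2 * q ^+ 2 by rewrite -exprMn addr_ge0 ?sqr_ge0.
have h1 := ler_wpM2r S0 LA.
have h2 : mu * (b ^+ 2 + alpha ^+ 2 * q ^+ 2) <= alpha * - (a + alpha * c).
  have := ler_wpM2l (sqr_ge0 alpha) sI.
  have : mu * b ^+ 2 <= b ^+ 2 by rewrite ler_piMl ?sqr_ge0.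
  lra.
have rho1 : 0 <= 1 - rho by have := rho_lt; lra.
have := ler_wpM2l rho1 h2; lra.
Qed.

Lemma inactive_supported x p : nonneg x -> active_direction x p ->
  typeII f eps_g x -> subvec (~: I x) p = 0.
Proof.
move=> x0 pA /and3P[/negbTE nI _ _]; apply/subvec_eq0P => i.
rewrite -activeE // => iA; move: pA; rewrite /active_direction nI.
by move/subvec_eq0P; apply.
Qed.

Lemma small_step_proj x p alpha : nonneg x -> subvec (~: I x) p = 0 -> 0 <= alpha ->
    alpha * enorm (subvec (I x) p) <= e ->
  nonneg (x + alpha *: p) /\ Defs.proj (x + alpha *: p) = x + alpha *: p.
Proof.
move=> x0 /subvec_eq0P p0 a0 h.
have y0 i : 0 <= (x + alpha *: p) i 0.
  rewrite !mxE; have [iI|iI] := boolP (i \in I x); first exact: small_step_coord iI.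
  by rewrite p0 ?mulr0 ?addr0 ?nonneg_coord // inE.
split; first exact/forallP.
by apply/matrixP => i j; rewrite (ord1 j) mxE max_l.
Qed.

Lemma supported_slope x p : subvec (~: I x) p = 0 ->
  dot (grad f x) p = dot (subvec (I x) (grad f x)) (subvec (I x) p).
Proof. by move=> p0; rewrite (dot_split (I x)) p0 dot0r addr0. Qed.

Lemma supported_curvature x p : subvec (~: I x) p = 0 ->
  dot p (hess f x *m p) =
  dot (subvec (I x) p) (submat (I x) (hess f x) *m subvec (I x) p).
Proof. by move=> p0; rewrite (dot_split (I x)) p0 dot0l addr0 subvec_mulmx. Qed.

Lemma decrease_small_supported_step x p alpha : nonneg x -> subvec (~: I x) p = 0 ->
    0 <= alpha -> alpha * enorm (subvec (I x) p) <= e ->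
  f (Defs.proj (x + alpha *: p)) - f x <=
    alpha * dot (subvec (I x) (grad f x)) (subvec (I x) p)
    + (alpha ^+ 2 * dot (subvec (I x) p) (submat (I x) (hess f x) *m subvec (I x) p)
       + LH * (alpha * enorm (subvec (I x) p)) ^+ 3) / 2.
Proof.
move=> x0 p0 a0 h; have [y0 ->] := small_step_proj x0 p0 a0 h.
have := second_order_bound fC2 LH_ge0 hess_lip x0 y0.
rewrite enormZ ger0_norm // -scalemxAr !dotZr !dotZl -supported_slope //.
by rewrite -supported_curvature // mulrA -expr2 (enorm_supp p0).
Qed.

Lemma supported_active x p alpha : nonneg x -> active_direction x p ->
    typeII f eps_g x ->
  dot (subvec (A x) (grad f x)) (subvec (A x) (Defs.proj (x + alpha *: p) - x)) = 0.
Proof.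
move=> x0 pA /and3P[/negbTE nI _ _].
suff -> : subvec (A x) (Defs.proj (x + alpha *: p) - x) = 0 by rewrite dot0r.
apply/subvec_eq0P => i iA.
by have := active_coord alpha x0 pA iA; rewrite nI => <-; rewrite !mxE.
Qed.

Lemma typeII_grad x : typeII f eps_g x -> e ^+ 2 < enorm (subvec (I x) (grad f x)).
Proof. by case/and3P => _ _; rewrite /FO_c e_sqr -ltNge. Qed.

Lemma npc_length x p : typeII f eps_g x -> inactive_descent x p NPC ->
  omega * e ^+ 2 <= enorm (subvec (I x) p).
Proof.
move=> /typeII_grad g [_ _ _]; apply: le_trans.
by rewrite ler_wpM2l // ltW.
Qed.

(** The curvature term is nonpositive and can be dropped.  The cubic remainder is
    governed by alpha ^+ 2 * q <= (kap * e) ^+ 2 / q, which is bounded because q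
    is at least omega * e ^+ 2. *)
Lemma crit_npc x p alpha : nonneg x -> active_direction x p -> typeII f eps_g x ->
    inactive_descent x p NPC -> 0 < alpha ->
    alpha * enorm (subvec (I x) p) <= kap * e ->
  line_search_crit f eps_g rho x p alpha.
Proof.
move=> x0 pA xII pI a0 aq.
have qlb := npc_length xII pI.
have p0 := inactive_supported x0 pA xII.
have aqe : alpha * enorm (subvec (I x) p) <= e.
  by rewrite (le_trans aq) // ler_piMl ?sqrtr_ge0.
rewrite crit_dE supported_active // mulr0 add0r.
apply: le_trans (decrease_small_supported_step x0 p0 (ltW a0) aqe) _.
case: pI => _ curv -> _; rewrite -enorm_sqr.
move: curv aq qlb; move: (dot _ _) => c c0; have := enorm_ge0 (subvec (I x) p).
move: (enorm _) => q q0 aq qlb.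
have ac0 : alpha ^+ 2 * c <= 0 by rewrite mulr_ge0_le0 ?sqr_ge0.
have h1 : omega * (alpha ^+ 2 * q) <= kap.
  have e2 : 0 < e ^+ 2 by rewrite exprn_gt0.
  rewrite -(ler_pM2r e2); apply: (@le_trans _ _ ((alpha * q) ^+ 2)).
    rewrite exprMn mulrAC [leRHS](_ : _ = q * (alpha ^+ 2 * q)); last by ring.
    by rewrite ler_wpM2r ?(mulr_ge0 (sqr_ge0 alpha) q0).
  apply: (@le_trans _ _ ((kap * e) ^+ 2)).
    by rewrite ler_sqr ?nnegrE ?mulr_ge0 ?(ltW a0) ?(ltW kap_gt0) ?sqrtr_ge0.
  by rewrite exprMn ler_wpM2r ?(ltW e2) // expr2 ler_piMl ?(ltW kap_gt0).
have h2 : LH * (alpha ^+ 2 * q) <= 2 * (1 - rho).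
  rewrite -(ler_pM2r omega_gt0) (le_trans _ kap_npc) // -mulrA ler_wpM2l //.
  by rewrite mulrC.
have aq2 : 0 <= alpha * q ^+ 2 by rewrite mulr_ge0 ?sqr_ge0 // ltW.
have := ler_wpM2r aq2 h2.
rewrite (_ : (alpha * q) ^+ 3 = alpha ^+ 2 * q * (alpha * q ^+ 2)); last by ring.
lra.
Qed.

(** Since the curvature of s is at most minus its slope, the quadratic model
    decreases by at least half the slope, and half exceeds rho; the cubic
    remainder fits into the gap. *)
Lemma crit_full_step x p : nonneg x -> active_direction x p -> typeII f eps_g x ->
    inactive_descent x p SOL -> enorm (subvec (I x) p) <= kap * e ->
  line_search_crit f eps_g rho x p 1.
Proof.
move=> x0 pA xII [h1 h2 _] qk.
have p0 := inactive_supported x0 pA xII.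
have qe : 1 * enorm (subvec (I x) p) <= e.
  by rewrite mul1r (le_trans qk) // ler_piMl ?sqrtr_ge0.
rewrite crit_dE supported_active // mulr0 add0r.
apply: le_trans (decrease_small_supported_step x0 p0 ler01 qe) _.
rewrite expr1n !mul1r.
move: h1 h2 qk; rewrite -enorm_sqr.
move: (dot (subvec _ (grad _ _)) _) => b.
move: (dot _ (submat _ _ *m _)) => c; have := enorm_ge0 (subvec (I x) p).
move: (enorm _) => q q0 bc sc qk.
have LHq : LH * q <= (1 - 2 * rho) * sigma.
  apply: le_trans kap_LH; rewrite ler_wpM2l // (le_trans qk) //.
  by rewrite ler_piMr // ltW.
have := ler_wpM2r (sqr_ge0 q) LHq.
have r2 : 0 <= 1 - 2 * rho by have := rho_lt; lra.
have sb : sigma * q ^+ 2 <= - b by apply: (le_trans sc); rewrite lerNr.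
have := ler_wpM2l r2 sb.
rewrite (_ : q ^+ 3 = q * q ^+ 2); last by ring.
lra.
Qed.

(** The inactive set can only shrink, because the active coordinates did not move.
    The new gradient on the old inactive set is the MINRES residual, at most of
    order e * q, plus a Taylor remainder of order q ^+ 2, and q <= kap * e. *)
Lemma full_step_not_typeII x p : nonneg x -> active_direction x p -> typeII f eps_g x ->
    inactive_descent x p SOL -> enorm (subvec (I x) p) <= kap * e ->
  ~~ typeII f eps_g (Defs.proj (x + 1 *: p)).
Proof.
move=> x0 pA xII [_ _ h3] qk.
have p0 := inactive_supported x0 pA xII.
have qe : 1 * enorm (subvec (I x) p) <= e.
  by rewrite mul1r (le_trans qk) // ler_piMl ?sqrtr_ge0.
have [y0 ->] := small_step_proj x0 p0 ler01 qe; rewrite !scale1r in y0 *.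
rewrite /typeII !negb_and negbK; apply/orP; right; apply/orP; right.
rewrite negbK /FO_c -[leRHS]e_sqr.
have sub : I (x + p) \subset I x.
  apply/fintype.subsetP => i; rewrite !inE !mxE; apply: contraTT => iI.
  move/subvec_eq0P: p0 => -> ; first by rewrite addr0.
  by rewrite inE inE.
apply: le_trans (enorm_subvecS (grad f (x + p)) sub) _.
have := enorm_grad_second_order fC2 LH_ge0 hess_lip x0 y0.
have xp1 : nonneg (x + 1 *: p) by rewrite scale1r.
have := hess_bound fC2 Lg_ge0 LH_ge0 grad_lip hess_lip x0 ltr01 xp1.
rewrite (enorm_supp p0); set w := _ - _ - _.
have := enorm_subvec (I x) (hess f x *m p); rewrite subvec_mulmx //.
have := enorm_subvec (I x) w.
have -> : subvec (I x) (grad f (x + p)) =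
    subvec (I x) w + (submat (I x) (hess f x) *m subvec (I x) p + subvec (I x) (grad f x)).
  rewrite -subvec_mulmx // -!subvecD; congr (subvec _ _).
  by rewrite /w addrA subrK subrK.
move=> ww HH Hp wq; apply: le_trans (ler_enormD _ _) _.
move: h3 ww wq HH Hp qk; have := enorm_ge0 (subvec (I x) p).
move: (enorm w) (enorm (subvec _ w)) (enorm (hess _ _ *m _)) (enorm (_ *m _)) (enorm (_ + _)).
move: (enorm _) => q W w' h h' r q0 h3 ww wq HH Hp qk.
rewrite -(ler_pM2l sigma_gt0).
have et0 : 0 <= e * theta by rewrite mulr_ge0 // ltW.
have r1 : sigma * r <= theta * Lg * kap * e ^+ 2.
  apply: (le_trans h3); apply: (@le_trans _ _ (e * theta * (Lg * (kap * e)))).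
    by rewrite ler_wpM2l // (le_trans HH) // (le_trans Hp) // ler_wpM2l.
  by rewrite [leLHS](_ : _ = theta * Lg * kap * e ^+ 2) //; ring.
have r2 : sigma * w' <= sigma * LH * kap * e ^+ 2.
  rewrite -!mulrA ler_wpM2l ?(ltW sigma_gt0) // (le_trans ww) // (le_trans wq) //.
  rewrite ler_wpM2l // (@le_trans _ _ ((kap * e) ^+ 2)) //.
    by rewrite ler_sqr ?nnegrE ?(le_trans q0).
  by rewrite exprMn ler_wpM2r ?sqr_ge0 // expr2 ler_piMl // ltW.
have := ler_wpM2r (sqr_ge0 e) kap_grad; lra.
Qed.

(** All terms of the sum are nonnegative.  If (a) fails at i, the i-th term alone
    suffices.  If (b) fails, then either one defect x_i * g_i is at least e ^+ 2 in
    absolute value, and again its term suffices, or the pointwise bounds sum up to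
    the squared norm in (b). *)
Lemma typeI_active_decrease x p alpha a : nonneg x -> active_direction x p ->
    typeI f eps_g x -> 0 < a -> a <= alpha -> a <= 1 ->
  a * e ^+ 2 <=
  - dot (subvec (A x) (grad f x)) (subvec (A x) (Defs.proj (x + alpha *: p) - x)).
Proof.
move=> x0 pA xI a0 aal a1; have al0 := lt_le_trans a0 aal.
have e2 : 0 < e ^+ 2 by rewrite exprn_gt0.
set g := grad f x.
pose T i := - (g i 0 * (Num.max (x i 0 - alpha * g i 0) 0 - x i 0)).
have -> : - dot (subvec (A x) g) (subvec (A x) (Defs.proj (x + alpha *: p) - x)) =
    \sum_(i in A x) T i.
  rewrite dot_subvec -sumrN; apply: eq_bigr => i iA; congr (- (_ * _)).
  by have := active_coord alpha x0 pA iA; rewrite xI => <-; rewrite !mxE.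
have T0 i : 0 <= T i.
  rewrite oppr_ge0 -(pmulr_rle0 _ al0).
  rewrite (le_trans (projected_step_bound _ (nonneg_coord i x0) al0)) //.
  by rewrite oppr_le0 sqr_ge0.
have single i : i \in A x -> a * e ^+ 2 <= T i -> a * e ^+ 2 <= \sum_(i in A x) T i.
  by move=> iA /le_trans; apply; rewrite (bigD1 i) //= lerDl sumr_ge0.
have Ti i : i \in A x -> a * Num.min ((x i 0 * g i 0) ^+ 2) (e ^+ 2 * e ^+ 2) <= e ^+ 2 * T i.
  by rewrite inE => xe; apply: projected_step_decrease.
case/andP: xI => _ /orP[]; rewrite /FO_a /FO_b.
  rewrite negb_forall => /existsP[i]; rewrite negb_imply -ltNge => /andP[iA gi].
  apply: (single i iA); rewrite /T -/g in gi *.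
  have g0 : g i 0 <= 0 by rewrite ltW // (lt_trans gi) // oppr_lt0.
  have -> : Num.max (x i 0 - alpha * g i 0) 0 = x i 0 - alpha * g i 0.
    by rewrite max_l // addr_ge0 ?nonneg_coord // -mulrN mulr_ge0 ?oppr_ge0 // ltW.
  rewrite addrAC subrr add0r mulrN opprK (mulrCA (g i 0)) -expr2.
  apply: ler_pM; rewrite ?(ltW a0) ?sqr_ge0 //.
  by rewrite -[leRHS]sqrrN ler_sqr ?nnegrE ?oppr_ge0 ?sqrtr_ge0 // lerNr ltW.
rewrite -ltNge => FOb.
have {}FOb : e ^+ 2 * e ^+ 2 < \sum_(i in A x) (x i 0 * g i 0) ^+ 2.
  have : e ^+ 2 * e ^+ 2 < enorm (diag_mx (subvec (A x) x)^T *m subvec (A x) g) ^+ 2.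
    by rewrite -expr2 e_sqr ltr_sqr ?nnegrE ?enorm_ge0 // -e_sqr ltW.
  move/lt_le_trans; apply; rewrite enorm_sqr big_enum_val ler_sum // => i _.
  by rewrite mul_diag_mx !mxE expr2.
have [/exists_inP[i iA big]|/exists_inPn small] :=
  boolP [exists i in A x, e ^+ 2 * e ^+ 2 <= (x i 0 * g i 0) ^+ 2].
  apply: (single i iA); rewrite -(ler_pM2l e2) mulrCA.
  by have := Ti i iA; rewrite min_r.
rewrite -(ler_pM2l e2) mulrCA mulr_sumr.
apply: (@le_trans _ _ (\sum_(i in A x) a * (x i 0 * g i 0) ^+ 2)).
  by rewrite -mulr_sumr ler_wpM2l ?(ltW a0) // ltW.
apply: ler_sum => i iA; have := Ti i iA; rewrite min_l //.
by have := small i iA; rewrite -ltNge => /ltW.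
Qed.

Lemma crit_decrease x p D alpha : nonneg x -> active_direction x p ->
    inactive_descent x p D -> 0 < alpha -> line_search_crit f eps_g rho x p alpha ->
  rho * (- dot (subvec (A x) (grad f x)) (subvec (A x) (Defs.proj (x + alpha *: p) - x))
         + alpha * (mu * enorm (subvec (I x) p) ^+ 2))
  <= f x - f (Defs.proj (x + alpha *: p)).
Proof.
move=> x0 pA pI a0; rewrite crit_dE => ca.
have := ler_wpM2l (mulr_ge0 (ltW rho_gt0) (ltW a0)) (inactive_slope pI).
lra.
Qed.

Lemma active_decrease_ge0 x p alpha : nonneg x -> active_direction x p -> 0 < alpha ->
  0 <= - dot (subvec (A x) (grad f x)) (subvec (A x) (Defs.proj (x + alpha *: p) - x)).
Proof.
move=> x0 pA a0; rewrite oppr_ge0 -(pmulr_rle0 _ a0).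
by rewrite (le_trans (active_slope x0 pA a0)) // oppr_le0 sqr_ge0.
Qed.

(** The rejected step alpha / zeta violates one of the two conditions under which
    the first-order analysis would have accepted it. *)
Lemma step_size_dichotomy x p D alpha : nonneg x -> active_direction x p ->
    inactive_descent x p D -> 0 < alpha ->
    1 <= alpha \/ alpha / zeta <= 1 /\ ~~ line_search_crit f eps_g rho x p (alpha / zeta) ->
  zeta * kap <= alpha \/
  e <= enorm (subvec (I x) p) /\ zeta * e <= alpha * enorm (subvec (I x) p).
Proof.
move=> x0 pA pI a0 [a1|[az1 ncrit]].
  by left; rewrite (le_trans _ a1) // mulr_ile1 // ltW.
have az0 : 0 < alpha / zeta by rewrite divr_gt0.
have [ak|ak] := leP (alpha / zeta) kap; last first.
  by left; rewrite mulrC -ler_pdivlMr // ltW.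
have [aq|aq] := leP (alpha / zeta * enorm (subvec (I x) p)) e.
  by move: ncrit; rewrite (crit_first_order x0 pA pI) // az0.
right; split; first by rewrite (le_trans (ltW aq)) // ler_piMl ?enorm_ge0.
by rewrite mulrC -ler_pdivlMr // mulrAC ltW.
Qed.

Local Notation dec := (rho * zeta * kap ^+ 4 * e ^+ 3).

Let dec_le (a : R) : kap ^+ 4 * e ^+ 3 <= a -> dec <= rho * (zeta * a).
Proof. by move=> h; rewrite -(mulrA (rho * zeta)) -(mulrA rho)
  !ler_wpM2l ?(ltW rho_gt0) ?(ltW zeta_gt0). Qed.

Let kap_pow m n : (n <= m)%N -> kap ^+ m <= kap ^+ n.
Proof. by move=> nm; rewrite ler_wiXn2l // ltW. Qed.

Let e_pow m n : (n <= m)%N -> e ^+ m <= e ^+ n.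
Proof. by move=> nm; rewrite ler_wiXn2l // ltW. Qed.

Let pow_le m n : (m <= 4)%N -> (n <= 3)%N -> kap ^+ 4 * e ^+ 3 <= kap ^+ m * e ^+ n.
Proof. by move=> m4 n3; rewrite ler_pM ?exprn_ge0 ?kap_pow ?e_pow // ltW. Qed.

Lemma decrease_long_direction x p D alpha : nonneg x -> active_direction x p ->
    inactive_descent x p D -> 0 < alpha -> line_search_crit f eps_g rho x p alpha ->
    e <= enorm (subvec (I x) p) -> zeta * e <= alpha * enorm (subvec (I x) p) ->
  dec <= f x - f (Defs.proj (x + alpha *: p)).
Proof.
move=> x0 pA pI a0 ca eq zeq; apply: le_trans (crit_decrease x0 pA pI a0 ca).
have G := active_decrease_ge0 x0 pA a0.
apply: le_trans (dec_le (a := mu * (e * e)) _) _.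
  apply: le_trans (pow_le (m := 1) (n := 2) isT isT) _.
  by rewrite expr1 expr2 ler_wpM2r // mulr_ge0 // ltW.
rewrite ler_wpM2l ?(ltW rho_gt0) // ler_wpDl //.
set q := enorm _ in eq zeq *.
rewrite [leLHS](_ : _ = mu * (zeta * e * e)); last by ring.
rewrite [leRHS](_ : _ = mu * (alpha * q * q)); last by ring.
by rewrite ler_wpM2l ?(ltW mu_gt0) // ler_pM ?mulr_ge0 // ltW.
Qed.

Lemma typeI_decrease x p D alpha : nonneg x -> active_direction x p ->
    inactive_descent x p D -> typeI f eps_g x ->
    0 < alpha -> line_search_crit f eps_g rho x p alpha ->
    1 <= alpha \/ alpha / zeta <= 1 /\ ~~ line_search_crit f eps_g rho x p (alpha / zeta) ->
  dec <= f x - f (Defs.proj (x + alpha *: p)).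
Proof.
move=> x0 pA pI xI a0 ca fail.
have [zk|[]] := step_size_dichotomy x0 pA pI a0 fail; last first.
  exact: decrease_long_direction pI a0 ca.
apply: le_trans (crit_decrease x0 pA pI a0 ca).
have zk0 : 0 < zeta * kap by rewrite mulr_gt0.
have zk1 : zeta * kap <= 1 by rewrite mulr_ile1 // ltW.
have := typeI_active_decrease x0 pA xI zk0 zk zk1 => G.
apply: le_trans (dec_le (a := kap * e ^+ 2) _) _.
  exact: le_trans (pow_le (m := 1) (n := 2) isT isT) _.
rewrite ler_wpM2l ?(ltW rho_gt0) // mulrA ler_wpDr //.
by rewrite pmulr_rge0 // pmulr_rge0 // sqr_ge0.
Qed.

Lemma typeII_npc_decrease x p alpha : nonneg x -> active_direction x p ->
    inactive_descent x p NPC -> typeII f eps_g x ->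
    0 < alpha -> line_search_crit f eps_g rho x p alpha ->
    ~~ line_search_crit f eps_g rho x p (alpha / zeta) ->
  dec <= f x - f (Defs.proj (x + alpha *: p)).
Proof.
move=> x0 pA pI xII a0 ca ncrit.
have qlb := npc_length xII pI.
have az0 : 0 < alpha / zeta by rewrite divr_gt0.
have aq : zeta * (kap * e) <= alpha * enorm (subvec (I x) p).
  rewrite leNgt; apply: contra ncrit => h; apply: (crit_npc x0 pA xII pI az0).
  by rewrite mulrAC ler_pdivrMr // (mulrC _ zeta) ltW.
move: ca; rewrite crit_dE supported_active // mulr0 add0r.
case: pI => _ _ -> _; rewrite -enorm_sqr; set q := enorm _ in qlb aq *.
move=> ca; apply: le_trans (dec_le (a := kap * e * (omega * e ^+ 2)) _) _.
  apply: le_trans (pow_le (m := 2) (n := 3) isT isT) _.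
  rewrite [leLHS](_ : _ = kap * e * (kap * e ^+ 2)); last by ring.
  by rewrite ler_wpM2l ?mulr_ge0 ?(ltW kap_gt0) ?(ltW e_gt0) // ler_wpM2r ?sqr_ge0.
apply: (@le_trans _ _ (rho * (alpha * q * q))); last by lra.
rewrite ler_wpM2l ?(ltW rho_gt0) // mulrA.
by apply: ler_pM => //; rewrite ltW // !mulr_gt0.
Qed.

(** A short direction leads to a unit step that may gain little but ends Type II. *)
Lemma typeII_sol_progress x p alpha : nonneg x -> active_direction x p ->
    inactive_descent x p SOL -> typeII f eps_g x ->
    0 < alpha -> line_search_crit f eps_g rho x p alpha ->
    (line_search_crit f eps_g rho x p 1 -> alpha = 1) ->
    1 <= alpha \/ alpha / zeta <= 1 /\ ~~ line_search_crit f eps_g rho x p (alpha / zeta) ->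
  dec <= f x - f (Defs.proj (x + alpha *: p)) \/
  f (Defs.proj (x + alpha *: p)) <= f x /\ ~~ typeII f eps_g (Defs.proj (x + alpha *: p)).
Proof.
move=> x0 pA pI xII a0 ca full fail.
have G := active_decrease_ge0 x0 pA a0.
have decr := crit_decrease x0 pA pI a0 ca.
have [qk|qk] := leP (enorm (subvec (I x) p)) (kap * e).
  right; split; last first.
    by rewrite (full (crit_full_step x0 pA xII pI qk)); exact: full_step_not_typeII.
  rewrite -subr_ge0; apply: le_trans decr; apply: mulr_ge0; first exact: ltW.
  by rewrite addr_ge0 // pmulr_rge0 // pmulr_rge0 // sqr_ge0.
left; have [zk|[]] := step_size_dichotomy x0 pA pI a0 fail; last first.
  exact: decrease_long_direction pI a0 ca.
apply: le_trans decr.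
apply: le_trans (dec_le (a := kap * (mu * (kap * e) ^+ 2)) _) _.
  apply: le_trans (pow_le (m := 4) (n := 2) isT isT) _.
  rewrite [leLHS](_ : _ = kap * (kap * (kap * e) ^+ 2)); last by ring.
  by rewrite ler_wpM2l ?(ltW kap_gt0) // ler_wpM2r ?sqr_ge0.
rewrite ler_wpM2l ?(ltW rho_gt0) // ler_wpDl // mulrA.
have ke0 : 0 <= kap * e by rewrite mulr_ge0 // ltW.
apply: ler_pM => //; first by rewrite mulr_ge0 // ltW.
  by rewrite pmulr_rge0 // sqr_ge0.
by rewrite ler_wpM2l ?(ltW mu_gt0) // ler_sqr ?nnegrE ?enorm_ge0 // ltW.
Qed.

Lemma step_progress x p D alpha : nonneg x -> active_direction x p ->
    inactive_descent x p D -> ~~ alg2_stop f eps_g x ->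
    alg2_line_search f eps_g rho zeta x p D alpha ->
  let y := Defs.proj (x + alpha *: p) in
  dec <= f x - f y \/ [/\ typeII f eps_g x, f y <= f x & ~~ typeII f eps_g y].
Proof.
move=> x0 pA pI; rewrite /alg2_stop negb_and !negbK.
case: D pI => pI xI /=.
  move/(forward_backwardP zeta01) => [ca a0 nca az]; left.
  have fail : 1 <= alpha \/ alpha / zeta <= 1 /\
      ~~ line_search_crit f eps_g rho x p (alpha / zeta) by case: az; [left|right].
  case/orP: xI => xI; first exact: typeI_decrease pI xI a0 ca fail.
  exact: typeII_npc_decrease.
move/(backtrackingP zeta01) => [ca a0 full az].
have fail : 1 <= alpha \/ alpha / zeta <= 1 /\
    ~~ line_search_crit f eps_g rho x p (alpha / zeta).
  by case: az => [->|]; [left|right].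
case/orP: xI => xI; first by left; exact: typeI_decrease pI xI a0 ca fail.
have [|[]] := typeII_sol_progress x0 pA pI xI a0 ca full fail; first by left.
by right.
Qed.

(** In forward tracking an accepted step lowers f by at least
    rho * alpha * q ^+ 2, so accepted steps are bounded. *)
Lemma line_search_exists x p D : nonneg x -> active_direction x p ->
    inactive_descent x p D ->
  exists alpha, alg2_line_search f eps_g rho zeta x p D alpha.
Proof.
move=> x0 pA pI; pose q := enorm (subvec (I x) p).
pose a := Num.min kap (e / (q + 1)).
have q1 : 0 < q + 1 by rewrite ltr_wpDl ?enorm_ge0.
have a0 : 0 < a by rewrite lt_min kap_gt0 divr_gt0.
have ca t : 0 < t <= a -> line_search_crit f eps_g rho x p t.
  case/andP => t0; rewrite le_min => /andP[tk tq].
  apply: (crit_first_order x0 pA pI); first by rewrite t0.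
  move: tq; rewrite ler_pdivlMr //; apply: le_trans.
  by rewrite ler_wpM2l ?(ltW t0) // lerDl.
case: D pI => pI; last exact: backtracking_exists a0 ca.
pose b := (f x - fstar) / (rho * q ^+ 2).
have q0 : 0 < rho * q ^+ 2.
  by case: pI => s0 _ _ _; rewrite mulr_gt0 // enorm_sqr dot_gt0.
apply: (@forward_backward_exists _ _ _ zeta01 _ b a0 ca) => t ct.
have [t0|t0] := leP t 0.
  by rewrite (le_trans t0) // divr_ge0 ?(ltW q0) // subr_ge0 f_bounded.
rewrite ler_pdivlMr //.
have G := active_decrease_ge0 x0 pA t0.
have fy := f_bounded (nonneg_proj (x + t *: p)).
move: ct; rewrite crit_dE; case: pI => _ _ -> _; rewrite -enorm_sqr -/q.
have := mulr_ge0 (ltW rho_gt0) G; lra.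
Qed.

Lemma direction_exists x : nonneg x -> exists p D, alg2_direction f eps_g theta x p D.
Proof.
move=> x0; set H := submat (I x) (hess f x); set g := subvec (I x) (grad f x).
pose vA : 'cV[R]_#|A x| := if typeI f eps_g x then - subvec (A x) (grad f x) else 0.
have AI : {in A x, forall i, i \notin I x} by move=> i; rewrite activeE // inE.
have IA : {in I x, forall i, i \notin A x} by move=> i; rewrite activeE // finset.in_setC negbK.
have Hsym : H^T = H := submat_sym (I x) (hess_sym fC2 x).
have [t [s [D sD]]] := @minres_terminates _ _ H g Hsym (e * theta) 0
  (mulr_ge0 (ltW e_gt0) (ltW theta_gt0)).
exists (embed vA + embed s), (if I x == finset.set0 then SOL else D).
rewrite /alg2_direction !subvecD !subvec_embed (subvec_embedC _ AI) (subvec_embedC _ IA).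
rewrite addr0 add0r; split=> //; case: ifP => [->|->] //.
by exists t.
Qed.

Lemma FO_point_at_stop x : nonneg x -> alg2_stop f eps_g x -> FO_point f eps_g x.
Proof.
move=> x0 /andP[nI nII]; rewrite /FO_point x0 /=.
have noentry (S : {set 'I_d}) (v : 'cV[R]_#|S|) : S = finset.set0 -> enorm v <= eps_g.
  move=> S0; suff -> : v = 0 by rewrite enorm0 -e_sqr sqr_ge0.
  by apply/matrixP => i; have := enum_valP i; rewrite {2}S0 inE.
have /andP[-> ->] : FO_a f eps_g x && FO_b f eps_g x.
  move: nI; rewrite /typeI negb_and negbK => /orP[/eqP A0|]; last first.
    by rewrite negb_or !negbK.
  apply/andP; split; last exact: noentry.
  by apply/forallP => i; rewrite A0 inE.
move: nII; rewrite /typeII nI /= negb_and !negbK => /orP[/eqP I0|-> //].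
exact: noentry.
Qed.

(** * Executions *)

Variable x0 : 'cV[R]_d.
Hypothesis x0_ge0 : nonneg x0.
Hypothesis res_reg : residual_regularity f eps_g theta rho zeta x0 omega.
Hypothesis kry_reg : krylov_regularity f eps_g theta rho zeta x0 sigma.
Local Notation iterate := (alg2_iterate f eps_g theta rho zeta x0).

Lemma iterate_nonneg k x : iterate k x -> nonneg x.
Proof.
by case=> // {}k y z _ [p [D [alpha [_ _ _ ->]]]]; apply: nonneg_proj.
Qed.

Lemma iterate_descent k x p D : iterate k x -> ~~ alg2_stop f eps_g x ->
    alg2_direction f eps_g theta x p D ->
  active_direction x p /\ inactive_descent x p D.
Proof.
move=> itx nstop [pA pI]; split=> //.
move: pI; case: ifP => [/eqP I0 ->|/negbT I0 [t mt]].
  have zero v : subvec (I x) v = 0 by apply/subvec_eq0P => i; rewrite I0 inE.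
  rewrite /inactive_descent !zero mulmx0 addr0 !dot0r enorm0 !mulr0 oppr0.
  by split.
have et0 : 0 <= e * theta by rewrite mulr_ge0 // ltW.
have Hsym := submat_sym (I x) (hess_sym fC2 x).
case: D mt => mt.
  have [r0 curv slope] := minres_npc mt.
  by split=> //; exact: (res_reg itx nstop I0 mt).
have [slope curv resid] := minres_sol Hsym sigma_gt0 et0 mt (kry_reg itx nstop I0 mt).
rewrite enorm_sqr in curv; split=> //.
by rewrite -enormN opprD.
Qed.

Lemma iterate_progress k x y : iterate k x -> alg2_step f eps_g theta rho zeta x y ->
  dec <= f x - f y \/ [/\ typeII f eps_g x, f y <= f x & ~~ typeII f eps_g y].
Proof.
move=> itx [p [D [alpha [nstop dir ls ->]]]].
have [pA pI] := iterate_descent itx nstop dir.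
exact: step_progress (iterate_nonneg itx) pA pI nstop ls.
Qed.

Lemma iterate_step_exists k x : iterate k x -> ~~ alg2_stop f eps_g x ->
  exists y, alg2_step f eps_g theta rho zeta x y.
Proof.
move=> itx nstop; have xp := iterate_nonneg itx.
have [p [D dir]] := direction_exists xp.
have [pA pI] := iterate_descent itx nstop dir.
have [alpha ls] := line_search_exists xp pA pI.
by exists (Defs.proj (x + alpha *: p)), p, D, alpha.
Qed.

Let dec_gt0 : 0 < dec.
Proof. by rewrite !mulr_gt0 ?exprn_gt0. Qed.

(** The last term is a credit of one paid step.  A Type II step that gains little
    starts without credit and earns it by ending Type II; any other step lowers f
    by at least [dec], and the factor 2 pays both for itself and for losing the credit. *)
Lemma iteration_count k x : iterate k x ->
  k%:R * dec <= 2 * (f x0 - f x) + (~~ typeII f eps_g x)%:R * dec.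
Proof.
elim=> [|{}k y z ity IH step].
  by rewrite mul0r subrr mulr0 add0r mulr_ge0 // ltW.
have := dec_gt0; rewrite -natr1 mulrDl mul1r.
have [h|[yII fzy zII]] := iterate_progress ity step; move: IH.
  case: (typeII _ _ y); case: (typeII _ _ z); rewrite /= ?mul0r ?mul1r; lra.
rewrite yII zII /= mul0r mul1r; lra.
Qed.

Lemma iteration_bound k x : iterate k x ->
  k%:R <= (2 * (f x0 - fstar) / (rho * zeta * kap ^+ 4) + 1) * e ^- 3.
Proof.
move=> itx; set c := rho * zeta * kap ^+ 4.
have c0 : 0 < c by rewrite !mulr_gt0 ?exprn_gt0.
have e3 : 0 < e ^+ 3 by rewrite exprn_gt0.
rewrite ler_pdivlMr // -(ler_pM2r c0) -(mulrA k%:R) (mulrC (e ^+ 3)).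
apply: le_trans (iteration_count itx) _.
rewrite [leRHS]mulrDl (mul1r c) divfK ?gt_eqF //.
have := f_bounded (iterate_nonneg itx).
have : (~~ typeII f eps_g x)%:R * dec <= c.
  case: (~~ _); rewrite ?mul0r ?mul1r; last exact: ltW.
  by rewrite -[leRHS]mulr1 ler_wpM2l ?(ltW c0) // exprn_ile1 // ltW.
lra.
Qed.

(** An execution that never stops could be prolonged beyond the bound. *)
Lemma terminates : exists K x, iterate K x /\ alg2_stop f eps_g x.
Proof.
apply: contrapT => never.
have nstop k x : iterate k x -> ~~ alg2_stop f eps_g x.
  by move=> itx; apply/negP => st; apply: never; exists k, x.
have long k : exists x, iterate k x.
  elim: k => [|k [x itx]]; first by exists x0; apply: alg2_iterate0.
  have [y st] := iterate_step_exists itx (nstop _ _ itx).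
  by exists y; apply: alg2_iterateS itx st.
set B := (2 * (f x0 - fstar) / (rho * zeta * kap ^+ 4) + 1) * e ^- 3.
have [x /iteration_bound] := long (Num.bound `|B|).
rewrite leNgt => /negP; apply; apply: le_lt_trans (ler_norm _) _; rewrite -/B.
exact: (archi_boundP (normr_ge0 B)).
Qed.

End Step.

Lemma analysis_constant {R : realType} (Lg LH sigma omega theta rho : R) :
    0 <= Lg -> 0 <= LH -> 0 < sigma -> 0 < omega -> 0 < theta -> 0 < rho < 1 / 2 ->
  exists mu kap : R, [/\ 0 < kap, kap <= mu, mu <= 1 & mu <= sigma] /\
    [/\ kap <= omega, Lg * kap <= (1 - rho) * mu, LH * kap <= (1 - 2 * rho) * sigma,
        LH * kap <= 2 * (1 - rho) * omega & (theta * Lg + sigma * LH) * kap <= sigma].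
Proof.
move=> Lg0 LH0 s0 w0 t0 /andP[r0 r1].
have [mu [mu0 mu1 mus]] : exists mu : R, [/\ 0 < mu, mu <= 1 & mu <= sigma].
  by exists (Num.min 1 sigma); rewrite lt_min ltr01 s0 !ge_min !lexx orbT.
(* a common positive lower bound of the right-hand sides, over a common upper
   bound of the coefficients *)
pose m := Num.min (Num.min mu omega) (Num.min (Num.min ((1 - rho) * mu)
  ((1 - 2 * rho) * sigma)) (Num.min (2 * (1 - rho) * omega) sigma)).
pose M := 1 + Lg + LH + (theta * Lg + sigma * LH).
have tl : 0 <= theta * Lg by rewrite mulr_ge0 // ltW.
have sl : 0 <= sigma * LH by rewrite mulr_ge0 // ltW.
have M0 : 0 < M by rewrite /M; lra.
have m0 : 0 < m.
  by rewrite !lt_min mu0 w0 s0 /= !mulr_gt0 //; lra.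
have mM a b : 0 <= a <= M -> m <= b -> a * (m / M) <= b.
  move=> /andP[a0 aM] mb; apply: le_trans mb.
  by rewrite mulrCA ler_piMr ?(ltW m0) // ler_pdivrMr // mul1r.
have [[m1 m2] [m3 m4] [m5 m6]] : [/\ m <= mu /\ m <= omega,
    m <= (1 - rho) * mu /\ m <= (1 - 2 * rho) * sigma &
    m <= 2 * (1 - rho) * omega /\ m <= sigma].
  by have := lexx m; rewrite {2}/m !le_min => /andP[/andP[-> ->] /andP[/andP[-> ->] /andP[-> ->]]].
exists mu, (m / M); split; split; rewrite ?divr_gt0 ?ge_min ?lexx ?orbT //.
- by rewrite -[m / M]mul1r mM //; rewrite /M; lra.
- by rewrite -[m / M]mul1r mM //; rewrite /M; lra.
- by rewrite mM //; rewrite /M; lra.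
- by rewrite mM //; rewrite /M; lra.
- by rewrite mM //; rewrite /M; lra.
- by rewrite mM //; rewrite /M; lra.
Qed.

(** * Complexity of the algorithm *)

Unset Implicit Arguments.

Theorem theorem3p8 (R : realType) (Delta Lg LH sigma omega theta rho zeta : R)
    (Lg_ge0 : 0 <= Lg) (LH_ge0 : 0 <= LH)
    (sigma_gt0 : 0 < sigma) (omega_gt0 : 0 < omega) (theta_gt0 : 0 < theta)
    (rho_range : 0 < rho < 1 / 2) (zeta_range : 0 < zeta < 1) :
  exists C : R,
  forall (d : nat) (f : 'cV[R]_d -> R) (fstar : R) (x0 : 'cV[R]_d) (eps_g : R),
    0 < eps_g < 1 ->
    C2 f ->
    nonneg x0 ->
    f x0 - fstar = Delta ->
    (forall x y, nonneg x -> nonneg y ->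
       enorm (grad f x - grad f y) <= Lg * enorm (x - y)) ->
    (forall x y, nonneg x -> nonneg y ->
       opnorm (hess f x - hess f y) <= LH * enorm (x - y)) ->
    (forall x, nonneg x -> fstar <= f x) ->
    residual_regularity f eps_g theta rho zeta x0 omega ->
    krylov_regularity f eps_g theta rho zeta x0 sigma ->
    [/\ (* the algorithm terminates, at an eps_g-FO point, within the bound *)
        exists (K : nat) (x : 'cV[R]_d),
          [/\ alg2_iterate f eps_g theta rho zeta x0 K x,
              alg2_stop f eps_g x, FO_point f eps_g x
            & K%:R <= C * eps_g `^ (- (3 / 2))],
        (* no execution is longer than the bound *)
        forall (k : nat) (x : 'cV[R]_d),
          alg2_iterate f eps_g theta rho zeta x0 k x ->
          k%:R <= C * eps_g `^ (- (3 / 2))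
      & (* executions stop only at FO points and never get stuck before *)
        forall (k : nat) (x : 'cV[R]_d),
          alg2_iterate f eps_g theta rho zeta x0 k x ->
          (alg2_stop f eps_g x -> FO_point f eps_g x) /\
          (~~ alg2_stop f eps_g x ->
             exists y, alg2_step f eps_g theta rho zeta x y)].
Proof.
have [mu [kap [[kap0 kap_mu mu1 mu_sigma] [kap_omega kap_Lg kap_LH kap_npc kap_grad]]]] :=
  analysis_constant Lg_ge0 LH_ge0 sigma_gt0 omega_gt0 theta_gt0 rho_range.
exists (2 * Delta / (rho * zeta * kap ^+ 4) + 1).
move=> d f fstar x0 eps_g eps01 fC2 x0_ge0 <- grad_lip hess_lip f_bounded res_reg kry_reg.
have -> : eps_g `^ (- (3 / 2)) = Num.sqrt eps_g ^- 3.
  have e0 : 0 <= eps_g by rewrite ltW //; case/andP: eps01.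
  rewrite powRN -powR12_sqrt // -powR_mulrn ?powR_ge0 // -powRrM.
  by congr ((_ `^ _)^-1); field.
have bound := iteration_bound eps01 fC2 Lg_ge0 LH_ge0 sigma_gt0 omega_gt0 theta_gt0
  rho_range zeta_range grad_lip hess_lip f_bounded kap0 kap_mu mu1 mu_sigma
  kap_omega kap_Lg kap_LH kap_npc kap_grad x0_ge0 res_reg kry_reg.
have [K [x [itx stx]]] := terminates eps01 fC2 Lg_ge0 LH_ge0 sigma_gt0 omega_gt0
  theta_gt0 rho_range zeta_range grad_lip hess_lip f_bounded kap0 kap_mu mu1 mu_sigma
  kap_omega kap_Lg kap_LH kap_npc kap_grad x0_ge0 res_reg kry_reg.
have stop_FO k y : alg2_iterate f eps_g theta rho zeta x0 k y ->
    alg2_stop f eps_g y -> FO_point f eps_g y.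
  by move=> ity; apply: (FO_point_at_stop eps01); apply: iterate_nonneg ity.
split.
- by exists K, x; split=> //; [exact: stop_FO itx stx | exact: bound itx].
- exact: bound.
move=> k y ity; split; first exact: stop_FO ity.
exact: (iterate_step_exists eps01 fC2 Lg_ge0 sigma_gt0 theta_gt0 rho_range zeta_range
  grad_lip f_bounded kap0 mu1 mu_sigma kap_Lg x0_ge0 res_reg kry_reg ity).
Qed.
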